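(* Fix $K\subset\{1,\dots,2d\}$ and $\mathbf A\in\mathcal O_K^{\mathbb C}$ satisfying the non-degeneracy assumption: $R$ and $E_0^*(S_2^*E_1R^{-1}S_2-S_3)E_0$ are invertible if $K_2\neq\emptyset$; $R$ is invertible if $K_2=\emptyset$. Write $\lambda_n(\boldsymbol\omega)=\lambda_n(\boldsymbol\omega,\mathbf A)$ for $\boldsymbol\omega\in\Omega_N^{\mathbb C}$. (1) Let $0\le k\le l_1$. Then the restriction of $\lambda_n$ to $\mathcal E_k$ is continuous for every $1\le n\le Nd-k$. (2) Let $(r^0,r^+,r^-)$ and $(r_1^0,r_1^+,r_1^-)$ be (attainable) triples of nonnegative integers, each with sum $d$, such that $0\le r^0<r_1^0\le l_1$ and $r^\pm\ge r_1^\pm$. Then for any $\boldsymbol\omega\in\mathcal E^{(r_1^0,r_1^+,r_1^-)}$, $$\lim_{\mathcal E^{(r^0,r^+,r^-)}\ni\boldsymbol\sigma\to\boldsymbol\omega}\lambda_n(\boldsymbol\sigma)=-\infty,\quad 1\le n\le r^--r_1^-,$$ $$\lim_{\mathcal E^{(r^0,r^+,r^-)}\ni\boldsymbol\sigma\to\boldsymbol\omega}\lambda_n(\boldsymbol\sigma)=\lambda_{n-(r^--r_1^-)}(\boldsymbol\omega),\quad r^--r_1^-<n\le Nd-r^0-(r^+-r_1^+),$$ $$\lim_{\mathcal E^{(r^0,r^+,r^-)}\ni\boldsymbol\sigma\to\boldsymbol\omega}\lambda_n(\boldsymbol\sigma)=+\infty,\quad Nd-r^0-(r^+-r_1^+)<n\le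 Nd-r^0.$$ Consequently, the singular set in $\Omega_N^{\mathbb C}$ is $\bigcup_{1\le k\le l_1}\mathcal E_k$.
   Context: Let $d\ge1$, $N\ge2$. $\Omega_N^{\mathbb C}$ is the set of $\boldsymbol\omega=(\{P_j^{-1}\}_{j=0}^N,\{Q_i\}_{i=1}^N,\{W_i\}_{i=1}^N)$ with all $P_j,Q_i,W_i$ complex $d\times d$ Hermitian matrices, $P_j$ invertible and $W_i$ positive definite. It is topologized as a subset of $\mathbb C^{(3N+1)d^2}$. $\mathcal B^{\mathbb C}$ is the space of self-adjoint boundary conditions: the quotient of $\{(A,B)\in\mathcal M_{2d,4d}(\mathbb C):\operatorname{rank}(A,B)=2d,\ AB^*=BA^*\}$ ($A,B$ being $2d\times2d$) by left multiplication by $\mathrm{GL}(2d,\mathbb C)$. The class of $(A,B)$ is written $[A\,|\,B]$. The discrete Sturm-Liouville problem $(\boldsymbol\omega,\mathbf A)$, $\mathbf A=[A\,|\,B]$, is $$-\nabla(P_i\Delta y_i)+Q_iy_i=\lambda W_iy_i,\ 1\le i\le N,\qquad A\begin{pmatrix}-y_0\\ y_N\end{pmatrix}+B\begin{pmatrix}P_0\Delta y_0\\ P_N\Delta y_N\end{pmatrix}=0,$$ where $y=\{y_i\}_{i=0}^{N+1}$, $y_i\in\mathbb C^d$, $\Delta y_i=y_{i+1}-y_i$, $\nabla x_i=x_i-x_{i-1}$ (so $\nabla(P_i\Delta y_i)=P_i\Delta y_i-P_{i-1}\Delta y_{i-1}$). $\lambda$ is an eigenvalue if there is a nontrivial solution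 $y$ (an eigenfunction). The multiplicity is the number of linearly independent eigenfunctions. The spectrum is real and finite, $\sharp_1(\sigma(\boldsymbol\omega,\mathbf A))$ is the number of eigenvalues counted with multiplicity (always $\le Nd$), and they are listed as $\lambda_1(\boldsymbol\omega,\mathbf A)\le\lambda_2(\boldsymbol\omega,\mathbf A)\le\cdots\le\lambda_{\sharp_1(\sigma(\boldsymbol\omega,\mathbf A))}(\boldsymbol\omega,\mathbf A)$. For $K\subset\{1,\dots,2d\}$ put $K_1=K\cap\{1,\dots,d\}$, $K_2=K\cap\{d+1,\dots,2d\}$, $r=\sharp(K_2)$. $E_1$ is the diagonal $d\times d$ matrix whose $i$-th diagonal entry is $0$ if $i\in K_1$ and $1$ otherwise. $E_2$ is the diagonal $d\times d$ matrix whose $i$-th diagonal entry is $0$ if $d+i\in K_2$ and $1$ otherwise. Let $$E_K=\begin{pmatrix}E_1&0&I_d-E_1&0\\ 0&E_2&0&I_d-E_2\\ E_1-I_d&0&E_1&0\\ 0&E_2-I_d&0&E_2\end{pmatrix},$$ and $\mathcal O_K^{\mathbb C}=\{[(S\,|\,I_{2d})E_K]:S \text{ a Hermitian }2d\times2d\text{ matrix}\}$. For $\mathbf A=[(S\,|\,I_{2d})E_K]$ write $S=\begin{pmatrix}S_1&S_2\\ S_2^*&S_3\end{pmatrix}$ with $d\times d$ blocks, and let $(A,B)=(S,I_{2d})E_K=(A_1,A_2,B_1,B_2)$ with $2d\times d$ blocks. Let $R=S_1E_1+E_1-I_d$. If $K_2=\{k_1+d,\dots,k_r+d\}\ne\emptyset$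 with $k_1<\dots<k_r$, let $E_0=(e_{k_1},\dots,e_{k_r})$, with $e_i$ the $i$-th column of $I_d$, and $$\hat T_1=R^{-1}S_2E_0,\qquad \hat T_2=E_0^*(S_2^*E_1R^{-1}S_2-S_3)E_0.$$ For $\boldsymbol\omega\in\Omega_N^{\mathbb C}$ define the Hermitian $d\times d$ matrix $$T(\boldsymbol\omega)=P_0^{-1}+R^{-1}(S_1(I_d-E_1)+E_1)-\hat T_1\hat T_2^{-1}\hat T_1^*\ \text{ if }K_2\ne\emptyset,\qquad T(\boldsymbol\omega)=P_0^{-1}+R^{-1}(S_1(I_d-E_1)+E_1)\ \text{ if }K_2=\emptyset,$$ and $F(\boldsymbol\omega)=(A_1P_0^{-1}+B_1,\,B_2)$, a $2d\times 2d$ matrix. For Hermitian $M$, $r^0(M),r^+(M),r^-(M)$ are the total multiplicities of its zero, positive, negative eigenvalues. $r^0(F(\boldsymbol\omega))$ means $2d-\operatorname{rank}F(\boldsymbol\omega)$. Let $l_1=\max_{\boldsymbol\omega\in\Omega_N^{\mathbb C}}r^0(F(\boldsymbol\omega))$ and $$\mathcal E_k=\{\boldsymbol\omega\in\Omega_N^{\mathbb C}:r^0(F(\boldsymbol\omega))=k\}\ (0\le k\le l_1),\qquad \mathcal E^{(r^0,r^+,r^-)}=\{\boldsymbol\omega\in\Omega_N^{\mathbb C}:r^0(T(\boldsymbol\omega))=r^0,\ r^\pm(T(\boldsymbol\omega))=r^\pm\}$$ for attainable nonnegative integers with $r^0+r^++r^-=d$ (attainable means the set is nonempty). Singular set: $\lambda_n$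 ($1\le n\le Nd$) is regarded as a function on the part of the considered space where there are at least $n$ eigenvalues. The singular set is the set of points of the space at which some $\lambda_n$ is discontinuous. Here a point at which $\lambda_n$ is not defined but which is a limit of points at which it is defined counts as a discontinuity point. *)

(* Defs.v *)
From HB Require Import structures.
From mathcomp Require Import all_boot all_order all_algebra.
From mathcomp Require Import sesquilinear spectral complex.
From mathcomp Require Import all_classical all_reals all_analysis.
Set Implicit Arguments.
Unset Strict Implicit.
Unset Printing Implicit Defensive.
Import Order.TTheory GRing.Theory Num.Theory.
Import numFieldNormedType.Exports.

Local Open Scope classical_set_scope.
Local Open Scope ring_scope.
Local Open Scope complex_scope.
Local Open Scope sesquilinear_scope.

(* R[i] typed as a numClosedFieldType: it then carries the topology of its
   norm, and matrices over it the entrywise topology. *)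
Definition cplx (R : realType) : numClosedFieldType := R[i].

Section Hermitian.
Context {R : realType} {n : nat}.
Local Notation C := (cplx R).

Definition posdefmx (M : 'M[C]_n) : Prop :=
  M \is hermsymmx /\
  forall v : 'cV[C]_n, v != 0 -> 0 < (v^t* *m M *m v) ord0 ord0.

(* The roots of the characteristic polynomial, repeated with multiplicity. *)
Definition eigenvalues (M : 'M[C]_n) : seq C :=
  sval (closed_field_poly_normal (char_poly M)).

Definition r_zero (M : 'M[C]_n) : nat := count (fun x => x == 0) (eigenvalues M).
Definition r_pos (M : 'M[C]_n) : nat := count (fun x => 0 < x) (eigenvalues M).
Definition r_neg (M : 'M[C]_n) : nat := count (fun x => x < 0) (eigenvalues M).

End Hermitian.

Section Problem.
Context {R : realType} {d N : nat}.
Local Notation C := (cplx R).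

(* The ambient space C^{(3N+1)d^2} of triples ({P_j^{-1}}, {Q_i}, {W_i}), with
   the product topology. Index j : 'I_N.+1 stands for P_j (0 <= j <= N), index
   i : 'I_N for Q_{i+1} and W_{i+1}. *)
Definition coefs : Type :=
  ({ptws 'I_N.+1 -> 'M[C]_d} * {ptws 'I_N -> 'M[C]_d} * {ptws 'I_N -> 'M[C]_d})%type.

HB.instance Definition _ := Topological.on coefs.

Definition Pinv (om : coefs) (j : 'I_N.+1) : 'M[C]_d := om.1.1 j.
Definition Qmx (om : coefs) (i : 'I_N) : 'M[C]_d := om.1.2 i.
Definition Wmx (om : coefs) (i : 'I_N) : 'M[C]_d := om.2 i.
Definition Pmx (om : coefs) (j : 'I_N.+1) : 'M[C]_d := invmx (Pinv om j).

Definition Omega : set coefs := [set om |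
  [/\ forall j, Pinv om j \is hermsymmx /\ Pinv om j \in unitmx,
      forall i, Qmx om i \is hermsymmx &
      forall i, posdefmx (Wmx om i)]].

(* A pair (A, B) is encoded as row_mx A B, and the class [A | B] as the set of
   all its representatives. *)
Definition bcond : Type := set 'M[C]_(d + d, (d + d) + (d + d)).

Definition bclass (M : 'M[C]_(d + d, (d + d) + (d + d))) : bcond :=
  [set G *m M | G in [set G : 'M[C]_(d + d) | G \in unitmx]].

Definition calB : set bcond := [set bA |
  exists A B : 'M[C]_(d + d),
    [/\ \rank (row_mx A B) = (d + d)%N, A *m B^t* = B *m A^t* &
        bA = bclass (row_mx A B)]].

Definition seqs : Type := {ffun 'I_N.+2 -> 'cV[C]_d}.

(* P_j (y_{j+1} - y_j), for 0 <= j <= N *)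
Definition PDelta (om : coefs) (y : seqs) (j : nat) : 'cV[C]_d :=
  Pmx om (inord j) *m (y (inord j.+1) - y (inord j)).

Definition solves (om : coefs) (bA : bcond) (z : C) (y : seqs) : Prop :=
  (forall i : 'I_N,
      - (PDelta om y i.+1 - PDelta om y i) + Qmx om i *m y (inord i.+1)
      = z *: (Wmx om i *m y (inord i.+1))) /\
  (forall M, bA M ->
      lsubmx M *m col_mx (- y (inord 0)) (y (inord N))
      + rsubmx M *m col_mx (PDelta om y 0) (PDelta om y N) = 0).

Definition is_eigenfunction om bA z (y : seqs) : Prop :=
  y != 0 /\ solves om bA z y.

Definition is_eigenvalue om bA z : Prop := exists y, is_eigenfunction om bA z y.

(* The maximal size of a linearly independent family of eigenfunctions. *)
Definition multiplicity om bA z : nat :=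
  \max_(m < (\dim {: seqs}).+1 |
        `[< exists ys : m.-tuple seqs,
              free ys /\ forall y, y \in ys -> is_eigenfunction om bA z y >]) m.

Definition is_spectrum om bA (s : seq R) : Prop :=
  [/\ sorted <=%R s,
      forall z : C, is_eigenvalue om bA z <-> z \in [seq x%:C | x <- s] &
      forall z : C, is_eigenvalue om bA z ->
        count_mem z [seq x%:C | x <- s] = multiplicity om bA z].

Definition spectrum om bA : seq R := xget [::] [set s | is_spectrum om bA s].

Definition nb_eigenvalues om bA : nat := size (spectrum om bA).

(* The n-th eigenvalue, 1 <= n <= nb_eigenvalues; 0 outside this range. *)
Definition lambda (bA : bcond) (n : nat) (om : coefs) : R :=
  nth 0 (spectrum om bA) n.-1.

Definition lambda_dom (bA : bcond) (n : nat) : set coefs :=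
  [set om | Omega om /\ (n <= nb_eigenvalues om bA)%N].

Definition singular_set (bA : bcond) : set coefs := [set om | Omega om /\
  exists n : nat, (1 <= n <= N * d)%N /\
    ((lambda_dom bA n om /\
      ~ (lambda bA n s @[s --> within (lambda_dom bA n) (nbhs om)]
           --> lambda bA n om)) \/
     (~ lambda_dom bA n om /\ closure (lambda_dom bA n) om))].

(* The coordinate charts. The elements lshift d i and rshift d i of 'I_(d + d)
   stand for the members i and d + i of {1, ..., 2d}. *)

Definition K_1 (K : {set 'I_(d + d)}) : {set 'I_d} := [set i | lshift d i \in K].
Definition K_2 (K : {set 'I_(d + d)}) : {set 'I_d} := [set i | rshift d i \in K].

Definition E_1 (K : {set 'I_(d + d)}) : 'M[C]_d :=
  diag_mx (\row_i (if i \in K_1 K then 0 else 1)).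
Definition E_2 (K : {set 'I_(d + d)}) : 'M[C]_d :=
  diag_mx (\row_i (if i \in K_2 K then 0 else 1)).

Definition E_chart (K : {set 'I_(d + d)}) : 'M[C]_((d + d) + (d + d)) :=
  block_mx
    (block_mx (E_1 K) 0 0 (E_2 K))
    (block_mx (1%:M - E_1 K) 0 0 (1%:M - E_2 K))
    (block_mx (E_1 K - 1%:M) 0 0 (E_2 K - 1%:M))
    (block_mx (E_1 K) 0 0 (E_2 K)).

Definition chart_mx (K : {set 'I_(d + d)}) (S : 'M[C]_(d + d)) :
  'M[C]_(d + d, (d + d) + (d + d)) := row_mx S 1%:M *m E_chart K.

Definition calO (K : {set 'I_(d + d)}) : set bcond :=
  [set bclass (chart_mx K S) | S in [set S | S \is hermsymmx]].

Section Chart.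
Variables (K : {set 'I_(d + d)}) (S : 'M[C]_(d + d)).

Let S_1 : 'M[C]_d := ulsubmx S.
Let S_2 : 'M[C]_d := ursubmx S.
Let S_3 : 'M[C]_d := drsubmx S.
Let A_1 : 'M[C]_(d + d, d) := lsubmx (lsubmx (chart_mx K S)).
Let B_1 : 'M[C]_(d + d, d) := lsubmx (rsubmx (chart_mx K S)).
Let B_2 : 'M[C]_(d + d, d) := rsubmx (rsubmx (chart_mx K S)).

Definition Rmx : 'M[C]_d := S_1 *m E_1 K + E_1 K - 1%:M.

(* enum_val lists K_2 in increasing order. *)
Definition E_0 : 'M[C]_(d, #|K_2 K|) := colsub enum_val 1%:M.

Definition That_1 : 'M[C]_(d, #|K_2 K|) := invmx Rmx *m S_2 *m E_0.
Definition That_2 : 'M[C]_#|K_2 K| :=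
  E_0^t* *m (S_2^t* *m E_1 K *m invmx Rmx *m S_2 - S_3) *m E_0.

Definition nondegeneracy : Prop :=
  Rmx \in unitmx /\ (K_2 K != finset.set0 -> That_2 \in unitmx).

Definition Tmx (om : coefs) : 'M[C]_d :=
  Pinv om ord0 + invmx Rmx *m (S_1 *m (1%:M - E_1 K) + E_1 K)
  - (if K_2 K == finset.set0 then 0
     else That_1 *m invmx That_2 *m That_1^t* ).

Definition Fmx (om : coefs) : 'M[C]_(d + d) :=
  row_mx (A_1 *m Pinv om ord0 + B_1) B_2.

Definition nullity (om : coefs) : nat := ((d + d) - \rank (Fmx om))%N.

Definition l_1 : nat :=
  \max_(k < (d + d).+1 | `[< exists2 om, Omega om & nullity om = k >]) k.

Definition calE (k : nat) : set coefs :=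
  [set om | Omega om /\ nullity om = k].

Definition calE_sign (r0 rp rm : nat) : set coefs :=
  [set om | Omega om /\
    [/\ r_zero (Tmx om) = r0, r_pos (Tmx om) = rp & r_neg (Tmx om) = rm]].

End Chart.
End Problem.

Arguments coefs : clear implicits.
Arguments bcond : clear implicits.
Arguments seqs : clear implicits.
Arguments l_1 {R d} N K S.
Arguments calE {R d} N K S k.
Arguments calE_sign {R d} N K S r0 rp rm.
Arguments lambda {R d} N bA n om.
Arguments lambda_dom {R d} N bA n.
Arguments singular_set {R d} N bA.

Section ChartsInB.
Context {R : realType} {d : nat}.
Local Notation C := (cplx R).
Implicit Types (K : {set 'I_(d + d)}).

Lemma diag01_trC (A : {set 'I_d}) :
  let D := diag_mx (\row_i (if i \in A then 0 else 1)) : 'M[C]_d in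
  D^t* = D /\ D *m D = D.
Proof.
move=> D; split.
  rewrite /D tr_diag_mx; apply/matrixP => i j; rewrite !mxE rmorphMn /=.
  by case: ifP; rewrite ?rmorph0 ?rmorph1.
rewrite /D mulmx_diag; congr diag_mx; apply/rowP => i; rewrite !mxE.
by case: ifP; rewrite ?mulr0 ?mulr1.
Qed.

Lemma trCD m n (A B : 'M[C]_(m, n)) : (A + B)^t* = A^t* + B^t*.
Proof. by rewrite linearD map_mxD. Qed.

Lemma trCB m n (A B : 'M[C]_(m, n)) : (A - B)^t* = A^t* - B^t*.
Proof. by rewrite linearB map_mxB. Qed.

Lemma trCM m n p (A : 'M[C]_(m, n)) (B : 'M[C]_(n, p)) :
  (A *m B)^t* = B^t* *m A^t*.
Proof. by rewrite trmx_mul map_mxM. Qed.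

Lemma trC1 n : (1%:M : 'M[C]_n)^t* = 1%:M.
Proof. by rewrite trmx1 map_mx1. Qed.

Lemma calO_sub_calB K : calO K `<=` @calB R d.
Proof.
move=> _ /= [S hS <-].
pose E : 'M[C]_(d + d) := block_mx (E_1 K) 0 0 (E_2 K).
have [h1 i1] := diag01_trC (K_1 K); have [h2 i2] := diag01_trC (K_2 K).
have hE : E^t* = E.
  by rewrite /E tr_block_mx map_block_mx !trmx0 !map_mx0 h1 h2.
have iE : E *m E = E.
  by rewrite /E mulmx_block !mul0mx !mulmx0 !addr0 !add0r i1 i2.
have EKE : @E_chart R d K = block_mx E (1%:M - E) (E - 1%:M) E.
  by rewrite /E_chart /E (scalar_mx_block d d) !opp_block_mx !add_block_mx !oppr0 !addr0.
have chE : chart_mx K S = row_mx (S *m E + (E - 1%:M)) (S *m (1%:M - E) + E).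
  by rewrite /chart_mx EKE mul_row_block !mul1mx.
have trS : S^t* = S by move/is_hermitianmxP: (hS : S \is hermsymmx) => {2}->; rewrite expr0 scale1r.
exists (S *m E + (E - 1%:M)), (S *m (1%:M - E) + E); split; last by rewrite -chE.
- have unitE : @E_chart R d K \in unitmx.
    suff : E_chart K *m block_mx E (E - 1%:M) (1%:M - E) E = 1%:M by case/mulmx1_unit.
    rewrite EKE mulmx_block !(mulmxBl, mulmxBr) !(mul1mx, mulmx1) !iE.
    rewrite [RHS](scalar_mx_block (d + d) (d + d)); congr block_mx;
      by rewrite !(subrr, sub0r, subr0, oppr0, addr0, add0r, opprK, opprB) ?subrK ?addrK ?subrKC ?subrr.
  rewrite -chE /chart_mx mxrankMfree ?row_free_unit //.
  apply/eqP; rewrite eqn_leq rank_leq_row /= -[X in (X <= _)%N](mxrank1 C).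
  have := mxrankM_maxl (row_mx S 1%:M) (col_mx 0 (1%:M : 'M[C]_(d + d))).
  by rewrite mul_row_col mulmx0 mulmx1 add0r.
- pose F : 'M[C]_(d + d) := 1%:M - E.
  have hF : F^t* = F by rewrite /F trCB trC1 hE.
  have EF : E *m F = 0 by rewrite mulmxBr mulmx1 iE subrr.
  have FE : F *m E = 0 by rewrite mulmxBl mul1mx iE subrr.
  have FF : F *m F = F by rewrite {1}/F mulmxBl mul1mx EF subr0.
  have FE1 : F + E = 1%:M by rewrite subrK.
  rewrite -(opprB 1%:M E) -/F; clearbody F.
  rewrite !(trCB, trCD, trCM) hE hF trS.
  rewrite !(mulmxBl, mulmxDl, mulmxBr, mulmxDr) !mulmxA.
  rewrite -!(mulmxA S) !(EF, FE, FF, iE) !(mulmx0, mul0mx).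
  rewrite !(add0r, addr0, subr0) [RHS]addrC; apply/eqP.
  rewrite subr_eq addrAC eq_sym subr_eq -mulmxDl -mulmxDr [E + F]addrC FE1.
  by rewrite mul1mx mulmx1.
Qed.

End ChartsInB.

(* Main.v *)
Require Import Defs.
From mathcomp Require Import all_boot all_order all_algebra.
From mathcomp Require Import sesquilinear spectral complex.
From mathcomp Require Import all_classical all_reals all_analysis.
From mathcomp Require Import ring lra zify.
Set Implicit Arguments.
Unset Strict Implicit.
Unset Printing Implicit Defensive.
Import Order.TTheory GRing.Theory Num.Theory.
Import numFieldNormedType.Exports.
Local Open Scope classical_set_scope.
Local Open Scope ring_scope.

(** The boundary condition is a Lagrangian relation between
    u = (-y_0, y_N) and v = (P_0 Delta y_0, P_N Delta y_N).  The
    non-degeneracy assumption says that the 2d x 2d matrix (A_1, B_2) is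
    invertible, that is, that the relation is the graph of a map
    (v_1, u_2) |-> (u_1, v_2).  Put x_0 = P_0 Delta y_0.  Eliminating y_0 and
    y_(N+1) leaves the unknowns x_0, y_1, .., y_N, and the problem becomes
    L(z) (x_0, y_1, .., y_N) = 0 for the Hermitian pencil

      L(z) = [ -T   b        ]
             [ b^H  M - z W  ]

    where T = T(omega) is the matrix of the statement, b is constant and onto,
    M is Hermitian, W is positive definite (solvesE).  All the entries of L(z)
    are continuous in omega, also where T is singular.  This is what makes the
    argument uniform: eliminating x_0 as well would require the inverse of T,
    whose blow-up is what sends eigenvalues to infinity.  In addition
    F = (A_1, B_2) [T 0; * 1], so that the nullity of F is that of T.

    Congruences that split off the invertible part of T and then the hyperbolic
    part created by its kernel show that there is a list of N d - r^0(T) reals,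
    which are the eigenvalues with their multiplicities, such that

      #{n : lambda_n < a} = r^-(L(a)) - d + r^-(T)

    for every real a (pencil_spectrum, spectrum_count).  If a is not an
    eigenvalue at omega then L(a) is invertible there, and its inertia does not
    change near omega, because r^- and r^+ are lower semicontinuous
    (r_neg_lsc).  Hence #{n : lambda_n < a} - r^-(T) is locally constant
    (near_count): in the passage from omega to a nearby sigma exactly
    r^-(T(sigma)) - r^-(T(omega)) new eigenvalues appear below each fixed
    level, the old ones are shifted by that amount in the list, and what
    remains lies above each fixed level.  This gives the three limits.

    Where the nullity of T is constant, its inertia is locally constant and the
    shift is zero, so that the eigenvalues are continuous.  If T is invertible
    at omega, it is so nearby, and omega is not singular by the same argument.  If T is singular there are
    fewer than N d eigenvalues, but adding a small scalar matrix to P_0^{-1}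
    makes T invertible, so lambda_(Nd) is undefined at omega and defined
    arbitrarily close to it. *)

(** * Hermitian matrices and their inertia *)

Section Inertia.
Local Open Scope complex_scope.
Local Open Scope sesquilinear_scope.
Context {R : realType}.
Local Notation C := (cplx R).

Lemma hermitianP n (H : 'M[C]_n) : (H \is hermsymmx) <-> (H^t* = H).
Proof.
split=> [/is_hermitianmxP h | h]; first by rewrite {2}h expr0 scale1r.
by apply/is_hermitianmxP; rewrite expr0 scale1r h.
Qed.

Lemma trCN m n (A : 'M[C]_(m, n)) : (- A)^t* = - A^t*.
Proof. by rewrite linearN map_mxN. Qed.

Lemma trCZ m n (a : C) (A : 'M[C]_(m, n)) : (a *: A)^t* = a^* *: A^t*.
Proof. by rewrite linearZ map_mxZ. Qed.

Lemma trC0 m n : (0 : 'M[C]_(m, n))^t* = 0.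
Proof. by rewrite trmx0 map_mx0. Qed.

Lemma trC_block m1 m2 n1 n2 (A : 'M[C]_(m1, n1)) (B : 'M[C]_(m1, n2))
    (D : 'M[C]_(m2, n1)) (E : 'M[C]_(m2, n2)) :
  (block_mx A B D E)^t* = block_mx (A^t* ) (D^t* ) (B^t* ) (E^t* ).
Proof. by rewrite tr_block_mx map_block_mx. Qed.

Lemma trC_col m1 m2 n (A : 'M[C]_(m1, n)) (B : 'M[C]_(m2, n)) :
  (col_mx A B)^t* = row_mx (A^t* ) (B^t* ).
Proof. by rewrite tr_col_mx map_row_mx. Qed.

Lemma trC_row m n1 n2 (A : 'M[C]_(m, n1)) (B : 'M[C]_(m, n2)) :
  (row_mx A B)^t* = col_mx (A^t* ) (B^t* ).
Proof. by rewrite tr_row_mx map_col_mx. Qed.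

(** Forms are written for row vectors: the rows of [G] are the vectors on
    which the form [H] is evaluated, and [G *m H *m G^t*] is their Gram matrix. *)
Lemma trC_congr m n (G : 'M[C]_(m, n)) (H : 'M[C]_n) :
  H^t* = H -> (G *m H *m G^t* )^t* = G *m H *m G^t*.
Proof. by move=> hH; rewrite !trCM trmxCK hH mulmxA. Qed.

Lemma char_poly_eigenvalues n (H : 'M[C]_n) :
  char_poly H = \prod_(x <- eigenvalues H) ('X - x%:P).
Proof.
rewrite /eigenvalues; case: closed_field_poly_normal => s /= {1}->.
by rewrite (monicP (char_poly_monic H)) scale1r.
Qed.

Lemma perm_eigenvalues n (H : 'M[C]_n) (s : seq C) :
  char_poly H = \prod_(x <- s) ('X - x%:P) -> perm_eq (eigenvalues H) s.
Proof.
by rewrite char_poly_eigenvalues; exact: prod_XsubC_eq.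
Qed.

Lemma perm_eigenvalues_diag n (H P : 'M[C]_n) (d : 'rV[C]_n) :
  P \in unitmx -> H = invmx P *m diag_mx d *m P ->
  perm_eq (eigenvalues H) [seq d 0 i | i <- enum 'I_n].
Proof.
move=> uP eH; apply: perm_eigenvalues.
transitivity (char_poly (diag_mx d)).
  rewrite /char_poly /char_poly_mx eH !map_mxM.
  have {1}-> : 'X%:M = map_mx polyC (invmx P) *m 'X%:M *m map_mx polyC P.
    rewrite -scalemx1 -scalemxAr -scalemxAl mulmx1.
    by rewrite -map_mxM mulVmx // map_mx1.
  rewrite -mulmxBl -mulmxBr !det_mulmx mulrC mulrA -det_mulmx -map_mxM.
  by rewrite mulmxV // map_mx1 det1 mul1r.
rewrite char_poly_trig ?diag_mx_is_trig // big_map big_enum /=.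
by apply: eq_bigr => i _; rewrite mxE eqxx.
Qed.

Lemma spectralE n (H : 'M[C]_n) : H^t* = H ->
  H = (spectralmx H)^t* *m diag_mx (spectral_diag H) *m spectralmx H.
Proof.
move/hermitianP/hermitian_normalmx/orthomx_spectralP => {1}->.
by rewrite invmx_unitary // spectral_unitarymx.
Qed.

Lemma count_eigenvalues n (H : 'M[C]_n) (p : pred C) : H^t* = H ->
  count p (eigenvalues H) = #|[pred i | p (spectral_diag H 0 i)]|.
Proof.
move=> hH; have := hH => /hermitianP/hermitian_normalmx/orthomx_spectralP eH.
have /permP -> := perm_eigenvalues_diag (spectral_unit H) eH.
by rewrite count_map enumT cardE /enum_mem size_filter.
Qed.

Lemma spectral_diag_real n (H : 'M[C]_n) i : H^t* = H ->
  spectral_diag H 0 i \is Num.real.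
Proof. by move/hermitianP/hermitian_spectral_diag_real/mxOverP. Qed.

Definition negdef n (H : 'M[C]_n) : Prop :=
  forall u : 'rV[C]_n, u != 0 -> (u *m H *m u^t* ) 0 0 < 0.

Lemma normsq_ge0 n (u : 'rV[C]_n) : 0 <= (u *m u^t* ) 0 0.
Proof.
by rewrite mxE; apply: sumr_ge0 => i _; rewrite !mxE mul_conjC_ge0.
Qed.

Lemma normsq_gt0 n (u : 'rV[C]_n) : u != 0 -> 0 < (u *m u^t* ) 0 0.
Proof.
move=> u0; rewrite lt0r normsq_ge0 andbT; apply: contra u0 => /eqP.
rewrite mxE => /psumr_eq0P h; apply/eqP/rowP => i; rewrite mxE.
have : u 0 i * (u^t* ) i 0 = 0.
  by apply: (h _ i) => // j _; rewrite !mxE mul_conjC_ge0.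
by move/eqP; rewrite !mxE mul_conjC_eq0 => /eqP.
Qed.

Lemma negdefN1 n : negdef (- 1%:M : 'M[C]_n).
Proof.
move=> u u0; rewrite mulmxN mulNmx mulmx1 mxE oppr_lt0; exact: normsq_gt0.
Qed.

(** The span of the eigenvectors with nonnegative eigenvalues has dimension
    [m - r_neg H] and meets the row space of [V] only in 0. *)
Lemma r_neg_ge m p (H : 'M[C]_m) (V : 'M[C]_(p, m)) : H^t* = H ->
  negdef (V *m H *m V^t* ) -> (p <= r_neg H)%N.
Proof.
move=> hH hV; set d := spectral_diag H; set P := spectralmx H.
pose A := [pred i | ~~ (d 0 i < 0)].
have rE : (r_neg H + #|A| = m)%N.
  by rewrite /r_neg count_eigenvalues // -/d -[RHS]card_ord -[RHS](cardC [pred i | d 0 i < 0]).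
(* the eigenvectors with nonnegative eigenvalues *)
pose N := rowsub (fun k : 'I_#|A| => enum_val k) P.
have PP : P *m P^t* = 1%:M by apply/unitarymxP/spectral_unitarymx.
have NE : N = rowsub (fun k : 'I_#|A| => enum_val k) 1%:M *m P by rewrite -rowsubE.
have NN : N *m N^t* = 1%:M.
  rewrite NE trCM mulmxA -(mulmxA _ P) PP mulmx1; apply/matrixP => i j; rewrite !mxE.
  rewrite (bigD1 (enum_val i)) //= big1 => [|k kn]; last by rewrite !mxE eq_sym (negbTE kn) mul0r.
  by rewrite !mxE eqxx mul1r addr0 eq_sym rmorph_nat (inj_eq enum_val_inj) eq_sym.
rewrite leqNgt; apply/negP => lt_p.
have hNHN (b : 'rV_#|A|) : 0 <= (b *m (N *m H *m N^t* ) *m b^t* ) 0 0.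
  have PH : P *m H *m P^t* = diag_mx d.
    by rewrite [X in P *m X](spectralE hH) !mulmxA PP mul1mx -mulmxA PP mulmx1.
  set E := rowsub _ 1%:M in NE.
  have -> : N *m H *m N^t* = E *m diag_mx d *m E^t* by rewrite NE trCM -PH !mulmxA.
  rewrite !mulmxA; set b' := b *m _; rewrite -mulmxA -trCM -/b'.
  have b'E i : b' 0 i = \sum_j b 0 j * E j i by rewrite mxE.
  clearbody b'; rewrite mul_mx_diag mxE sumr_ge0 // => i _.
  rewrite !mxE mulrAC.
  have [->|iA] := eqVneq (b' 0 i) 0; first by rewrite !mul0r.
  rewrite mulr_ge0 ?mul_conjC_ge0 //.
  have := spectral_diag_real i hH; rewrite realE -/d => /orP[//|di].
  have [k ek|hk] := pickP (fun k : 'I_#|A| => enum_val k == i).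
    by have := enum_valP k; rewrite (eqP ek) inE -real_leNgt ?real0 // realE di orbT.
  case/eqP: iA; rewrite b'E big1 // => k _.
  by rewrite !mxE (hk k) mulr0.
have : kermx (col_mx V N) != 0.
  rewrite kermx_eq0 -row_leq_rank -ltnNge.
  by apply: leq_ltn_trans (rank_leq_col _) _; rewrite -{1}rE ltn_add2r.
case/rowV0Pn => w /sub_kermxP; rewrite -[w]hsubmxK mul_row_col => e w0.
set a := lsubmx w in e w0; set b := rsubmx w in e w0.
have [a0|a0] := eqVneq a 0.
  move: e w0; rewrite a0 mul0mx add0r => /(congr1 (mulmx^~ (N^t* ))) /=.
  by rewrite -mulmxA NN mulmx1 mul0mx => ->; rewrite row_mx0 eqxx.
have := hV a a0.
have -> : a *m (V *m H *m V^t* ) *m a^t* = (a *m V) *m H *m (a *m V)^t* by rewrite trCM !mulmxA.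
have -> : a *m V = - (b *m N) by apply/eqP; rewrite -addr_eq0 e.
rewrite trCN mulNmx mulmxN mulNmx opprK trCM !mulmxA.
by have := hNHN b; rewrite !mulmxA => h1 h2; have := lt_geF h2; rewrite h1.
Qed.

(** Eigenvectors with negative eigenvalues, normalised: together with
    [r_neg_ge], [r_neg H] is the largest size of a negative definite Gram matrix. *)
Lemma r_neg_witness m (H : 'M[C]_m) : H^t* = H ->
  exists V : 'M[C]_(r_neg H, m), V *m H *m V^t* = - 1%:M.
Proof.
move=> hH; set d := spectral_diag H; set P := spectralmx H.
rewrite /r_neg count_eigenvalues // -/d; set A := [pred i | _].
have PP : P *m P^t* = 1%:M by apply/unitarymxP/spectral_unitarymx.
have PH : P *m H *m P^t* = diag_mx d.
  by rewrite [X in P *m X](spectralE hH) !mulmxA PP mul1mx -mulmxA PP mulmx1.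
pose c := \row_i (sqrtC (- d 0 i))^-1.
pose E : 'M[C]_(#|A|, m) := rowsub (fun k => enum_val k) 1%:M.
exists (E *m diag_mx c *m P).
have -> : E *m diag_mx c *m P *m H *m (E *m diag_mx c *m P)^t* =
    E *m diag_mx c *m diag_mx d *m (diag_mx c)^t* *m E^t*.
  by rewrite !trCM -PH !mulmxA.
rewrite -(mulmxA E) -(mulmxA E) tr_diag_mx map_diag_mx !mulmx_diag.
set e := \row_j _; rewrite -rowsubE; apply/matrixP => i j; rewrite !mxE.
rewrite (bigD1 (enum_val j)) //= big1 => [|k kj]; last first.
  by rewrite !mxE [enum_val j == k]eq_sym (negbTE kj) rmorph0 mulr0.
rewrite !mxE eqxx rmorph1 mulr1 addr0 (inj_eq enum_val_inj).
have [_|_] := eqVneq i j; last by rewrite mulr0n oppr0.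
rewrite !mulr1n mulrAC -normCK normfV exprVn -normrX sqrtCK.
have di : d 0 (enum_val i) < 0 by have := enum_valP i; rewrite inE.
by rewrite normrN ltr0_norm // invrN mulNr mulVf // lt_eqF.
Qed.

(** Here [G] may have any shape; a negative definite family for the
    compressed form pushes forward to one for [H]. *)
Lemma r_neg_congr_le m p (G : 'M[C]_(p, m)) (H : 'M[C]_m) : H^t* = H ->
  (r_neg (G *m H *m G^t* ) <= r_neg H)%N.
Proof.
move=> hH; have [V hV] := r_neg_witness (trC_congr G hH).
apply: (r_neg_ge (V := V *m G)) => //.
by rewrite trCM !mulmxA in hV *; rewrite hV; exact: negdefN1.
Qed.

(** Sylvester's law of inertia.  Only a left inverse is required of [G], so a
    change of frame may be given by a tall matrix, and no decomposition of the
    dimension [m] as a sum ever has to be made definitional. *)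
Lemma r_neg_congr m p (G : 'M[C]_(p, m)) (G' : 'M[C]_(m, p)) (H : 'M[C]_m) :
  H^t* = H -> G' *m G = 1%:M -> r_neg (G *m H *m G^t* ) = r_neg H.
Proof.
move=> hH GG; apply/eqP; rewrite eqn_leq r_neg_congr_le //=.
rewrite {1}[H](_ : _ = G' *m (G *m H *m G^t* ) *m G'^t* ).
  exact/r_neg_congr_le/trC_congr.
by rewrite !mulmxA GG mul1mx -mulmxA -trCM GG trC1 mulmx1.
Qed.

Lemma perm_eigenvaluesN n (H : 'M[C]_n) : H^t* = H ->
  perm_eq (eigenvalues (- H)) [seq - x | x <- eigenvalues H].
Proof.
move=> hH; have := hH => /hermitianP/hermitian_normalmx/orthomx_spectralP eH.
have p1 := perm_eigenvalues_diag (spectral_unit H) eH.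
have eNH : - H = invmx (spectralmx H) *m diag_mx (- spectral_diag H) *m spectralmx H.
  by rewrite linearN /= mulmxN mulNmx -eH.
rewrite (perm_trans (perm_eigenvalues_diag (spectral_unit H) eNH)) // perm_sym.
apply: perm_trans (perm_map _ p1) _; rewrite -map_comp.
by rewrite (eq_map (g := fun i => (- spectral_diag H) 0 i)) // => i /=; rewrite mxE.
Qed.

Lemma r_negN n (H : 'M[C]_n) : H^t* = H -> r_neg (- H) = r_pos H.
Proof.
move=> hH; rewrite /r_neg (permP (perm_eigenvaluesN hH)) count_map.
by apply: eq_count => x /=; rewrite oppr_lt0.
Qed.

Lemma r_posN n (H : 'M[C]_n) : H^t* = H -> r_pos (- H) = r_neg H.
Proof. by move=> hH; rewrite -r_negN ?opprK // trCN hH. Qed.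

Lemma r_pos_congr m p (G : 'M[C]_(p, m)) (G' : 'M[C]_(m, p)) (H : 'M[C]_m) :
  H^t* = H -> G' *m G = 1%:M -> r_pos (G *m H *m G^t* ) = r_pos H.
Proof.
move=> hH GG; rewrite -!r_negN ?trC_congr // -mulNmx -mulmxN.
by rewrite (r_neg_congr (G' := G')) // trCN hH.
Qed.

Lemma size_eigenvalues n (H : 'M[C]_n) : size (eigenvalues H) = n.
Proof.
have := congr1 (fun p : {poly C} => size p) (char_poly_eigenvalues H).
by rewrite size_char_poly size_prod_XsubC => -[].
Qed.

Lemma inertia_sum n (H : 'M[C]_n) : H^t* = H ->
  (r_zero H + r_pos H + r_neg H = n)%N.
Proof.
move=> hH; rewrite -[RHS](size_eigenvalues H) /r_zero /r_pos /r_neg.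
have : all (fun x => x \is Num.real) (eigenvalues H).
  rewrite all_count count_eigenvalues // size_eigenvalues -[X in _ == X]card_ord.
  by apply/eqP/eq_card => i; rewrite !inE spectral_diag_real.
elim: (eigenvalues H) => //= x s IH /andP[xr /IH <-].
by case: (real_ltgtP xr (real0 _)) => _ /=; lia.
Qed.

Lemma rank_diag_mx n (e : 'rV[C]_n) : \rank (diag_mx e) = #|[pred i | e 0 i != 0]|.
Proof.
set A := [pred i | _].
pose E : 'M[C]_(#|A|, n) := rowsub (fun k => enum_val k) 1%:M.
have EE : diag_mx e = E^T *m E *m diag_mx e.
  rewrite mul_mx_diag; apply/matrixP => i j; rewrite !mxE.
  have [ej|ej] := eqVneq (e 0 j) 0; first by case: eqP => [->|_]; rewrite ej mulr0 ?mul0rn.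
  have jA : j \in A by rewrite inE.
  rewrite (bigD1 (enum_rank_in jA j)) //= big1 => [|k kj]; last first.
    rewrite !mxE -[j in _ * (_ == j)%:R](enum_rankK_in jA jA) (inj_eq enum_val_inj).
    by rewrite (negbTE kj) mulr0.
  rewrite !mxE enum_rankK_in // eqxx mulr1 addr0 [j == i]eq_sym.
  by case: eqP => [->|_]; rewrite ?mul1r ?mul0r.
apply/eqP; rewrite eqn_leq; apply/andP; split.
  by rewrite EE -mulmxA; apply: leq_trans (mxrankM_maxl _ _) (rank_leq_col _).
have <- : \rank (E *m diag_mx e *m (diag_mx (map_mx (@GRing.inv _) e) *m E^T)) = #|A|.
  rewrite -mulmxA (mulmxA (diag_mx e)) mulmx_diag.
  apply/eqP; rewrite -[X in _ == X](mxrank1 C); apply/eqP; congr (\rank _).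
  rewrite mulmxA -rowsubE; apply/matrixP => i j; rewrite !mxE.
  rewrite (bigD1 (enum_val i)) //= big1 => [|k ki]; last first.
    by rewrite !mxE eq_sym (negbTE ki) mulr0n mul0r.
  have := enum_valP i; rewrite inE => ei.
  by rewrite !mxE eqxx mulr1n mulfV // mul1r addr0 (inj_eq enum_val_inj) eq_sym.
by apply: leq_trans (mxrankM_maxl _ _) (mxrankM_maxr _ _).
Qed.

Lemma rank_r_zero n (H : 'M[C]_n) : H^t* = H -> (\rank H + r_zero H = n)%N.
Proof.
move=> hH; have PP := spectral_unitarymx H.
rewrite {1}(spectralE hH) mxrankMfree ?row_free_unit ?spectral_unit //.
rewrite -mxrank_tr trmx_mul mxrankMfree; last first.
  by rewrite row_free_unit unitmx_tr -invmx_unitary // unitmx_inv spectral_unit.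
rewrite tr_diag_mx rank_diag_mx /r_zero count_eigenvalues // addnC.
rewrite -[RHS]card_ord -[RHS](cardC [pred i | spectral_diag H 0 i == 0]).
by congr (_ + _)%N.
Qed.

Lemma perm_eigenvalues_block m n (A : 'M[C]_m) (B : 'M[C]_n) :
  perm_eq (eigenvalues (block_mx A 0 0 B)) (eigenvalues A ++ eigenvalues B).
Proof.
apply: perm_eigenvalues.
rewrite /char_poly char_block_diag_mx det_ublock -!/(char_poly _).
by rewrite big_cat /= -!char_poly_eigenvalues.
Qed.

Lemma r_neg_block m n (A : 'M[C]_m) (B : 'M[C]_n) :
  r_neg (block_mx A 0 0 B) = (r_neg A + r_neg B)%N.
Proof. by rewrite /r_neg (permP (perm_eigenvalues_block A B)) count_cat. Qed.

Lemma r_pos_block m n (A : 'M[C]_m) (B : 'M[C]_n) :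
  r_pos (block_mx A 0 0 B) = (r_pos A + r_pos B)%N.
Proof. by rewrite /r_pos (permP (perm_eigenvalues_block A B)) count_cat. Qed.

Lemma perm_eigenvalues_scalar n (a : C) :
  perm_eq (eigenvalues (a%:M : 'M[C]_n)) (nseq n a).
Proof.
apply: perm_trans (perm_eigenvalues_diag (unitmx1 _ _) _) _.
- by rewrite invmx1 mul1mx mulmx1 -diag_const_mx; reflexivity.
- rewrite (eq_map (g := fun=> a)); last by move=> i; rewrite mxE.
  by rewrite -[in nseq n](size_enum_ord n); elim: (enum _) => //= x l; rewrite perm_cons.
Qed.

Lemma eigenvalues_real n (H : 'M[C]_n) : H^t* = H ->
  {in eigenvalues H, forall x, x = (complex.Re x)%:C}.
Proof.
move=> hH x; have := hH => /hermitianP/hermitian_normalmx/orthomx_spectralP eH.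
rewrite (perm_mem (perm_eigenvalues_diag (spectral_unit H) eH)).
by case/mapP => i _ ->; rewrite RRe_real // spectral_diag_real.
Qed.

Lemma perm_eigenvalues_shift n (H : 'M[C]_n) (a : C) : H^t* = H ->
  perm_eq (eigenvalues (H - a%:M)) [seq x - a | x <- eigenvalues H].
Proof.
move=> hH; have := hH => /hermitianP/hermitian_normalmx/orthomx_spectralP eH.
have p1 := perm_eigenvalues_diag (spectral_unit H) eH.
have e2 : H - a%:M = invmx (spectralmx H) *m
    diag_mx (spectral_diag H - const_mx a) *m spectralmx H.
  rewrite linearB /= mulmxBr mulmxBl -eH diag_const_mx.
  by rewrite -[a%:M in RHS]scalemx1 -scalemxAr mulmx1 -scalemxAl mulVmx ?spectral_unit // scalemx1.
rewrite (perm_trans (perm_eigenvalues_diag (spectral_unit H) e2)) // perm_sym.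
apply: perm_trans (perm_map _ p1) _; rewrite -map_comp.
by rewrite (eq_map (g := fun i => (spectral_diag H - const_mx a) 0 i)) // => i /=; rewrite !mxE.
Qed.

(** [- W] has [n] negative eigenvalues, so the family of [r_neg_witness] is a
    basis that is orthonormal for [W]. *)
Lemma posdef_orthonormal n (W : 'M[C]_n) : W^t* = W ->
  (forall u : 'rV[C]_n, u != 0 -> 0 < (u *m W *m u^t* ) 0 0) ->
  exists (G G' : 'M[C]_n), G *m W *m G^t* = 1%:M /\ G' *m G = 1%:M.
Proof.
move=> hW pW; have hNW : (- W)^t* = - W by rewrite trCN hW.
have [V hV] := r_neg_witness hNW.
have e : r_neg (- W) = n.
  apply/eqP; rewrite eqn_leq (r_neg_ge (V := 1%:M) hNW) ?andbT; last first.
    move=> u u0; rewrite trC1 mul1mx mulmx1 mulmxN mulNmx mxE oppr_lt0; exact: pW.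
  by rewrite -[X in (_ <= X)%N](size_eigenvalues (- W)) count_size.
move: V hV; rewrite e => V; rewrite mulmxN mulNmx => /oppr_inj hV.
exists V, (W *m V^t* ); split=> //.
by apply: mulmx1C; rewrite mulmxA.
Qed.

(** [Z] is an orthonormal basis of the kernel and [T'] the Moore-Penrose
    inverse, obtained by inverting the nonzero eigenvalues. *)
Lemma hermitian_kernel n (T : 'M[C]_n) : T^t* = T ->
  exists (Z : 'M[C]_(r_zero T, n)) (T' : 'M[C]_n),
    [/\ Z *m Z^t* = 1%:M, Z *m T = 0, T'^t* = T',
        T *m T' = 1%:M - Z^t* *m Z & T' *m T *m T' = T'].
Proof.
move=> hT; set d := spectral_diag T; set P := spectralmx T.
rewrite /r_zero count_eigenvalues // -/d; set A := [pred i | _].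
have PP : P *m P^t* = 1%:M by apply/unitarymxP/spectral_unitarymx.
have PP' : P^t* *m P = 1%:M by apply: mulmx1C.
have eT : T = P^t* *m diag_mx d *m P by exact: spectralE.
pose E : 'M[C]_(#|A|, n) := rowsub (fun k => enum_val k) 1%:M.
have EC : E^t* = E^T.
  by apply/matrixP => i j; rewrite !mxE rmorph_nat.
have EE : E *m E^T = 1%:M.
  apply/matrixP => i j; rewrite !mxE (bigD1 (enum_val i)) //= big1 => [|k kn]; last first.
    by rewrite !mxE eq_sym (negbTE kn) mul0r.
  by rewrite !mxE eqxx mul1r addr0 eq_sym (inj_eq enum_val_inj) eq_sym.
pose e : 'rV[C]_n := \row_i (d 0 i)^-1.
have ETE : E^T *m E = 1%:M - diag_mx d *m diag_mx e.
  apply/matrixP => i j; rewrite mulmx_diag !mxE.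
  have [jA|jA] := boolP (j \in A).
    have dj : d 0 j = 0 by apply/eqP; rewrite -[_ == _]/(j \in A).
    rewrite (bigD1 (enum_rank_in jA j)) //= big1 => [|k kj]; last first.
      rewrite !mxE -[j in _ * (_ == j)%:R](enum_rankK_in jA jA) (inj_eq enum_val_inj).
      by rewrite (negbTE kj) mulr0.
    rewrite !mxE enum_rankK_in // eqxx mulr1 addr0 [j == i]eq_sym.
    by case: eqP => [->|_]; rewrite ?dj ?mul0r ?mul0rn ?subr0.
  rewrite big1 => [|k _]; last first.
    rewrite !mxE [X in _ * X](_ : _ = 0) ?mulr0 //; case: eqP => // ek.
    by case/negP: jA; rewrite -ek; exact: enum_valP.
  have [->|_] := eqVneq i j; last by rewrite subr0.
  by rewrite !mulr1n mulfV ?subrr //; rewrite inE in jA.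
have dC : (diag_mx e)^t* = diag_mx e.
  rewrite tr_diag_mx map_diag_mx; congr diag_mx; apply/rowP => i; rewrite !mxE.
  by apply/CrealP; rewrite rpredV spectral_diag_real.
have ZE : forall i j, (E *m diag_mx d) i j = 0.
  move=> i j; rewrite mul_mx_diag !mxE; case: eqP => [<-|_]; last by rewrite mul0r.
  by have := enum_valP i; rewrite inE => /eqP ->; rewrite mulr0.
exists (E *m P), (P^t* *m diag_mx e *m P); split.
- by rewrite trCM mulmxA -(mulmxA E) PP mulmx1 EC.
- rewrite eT !mulmxA -(mulmxA E) PP mulmx1.
  suff -> : E *m diag_mx d = 0 by rewrite mul0mx.
  by apply/matrixP => i j; rewrite ZE mxE.
- by rewrite !trCM dC trmxCK mulmxA.
- rewrite {1}eT trCM EC !mulmxA -(mulmxA _ P) PP mulmx1 -(mulmxA _ E^T) ETE.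
  by rewrite mulmxBr mulmxBl mulmx1 PP' !mulmxA opprB addrC subrK.
- rewrite eT !mulmxA -!(mulmxA _ P (P^t* )) PP !mulmx1 -!(mulmxA (P^t* )) !mulmx_diag.
  congr (_ *m (diag_mx _ *m _)); apply/rowP => i; rewrite !mxE.
  have [->|h] := eqVneq (d 0 i) 0; first by rewrite invr0 !mul0r.
  by rewrite mulVf // mul1r.
Qed.
End Inertia.

(** * Spectrum and inertia of a degenerate Hermitian pencil *)

Section Pencil.
Local Open Scope complex_scope.
Local Open Scope sesquilinear_scope.
Context {R : realType}.
Local Notation C := (cplx R).



Lemma count_eigenvalues_scalar n (a : C) (p : pred C) :
  count p (eigenvalues (a%:M : 'M[C]_n)) = (p a * n)%N.
Proof. by rewrite (permP (perm_eigenvalues_scalar n a)) count_nseq. Qed.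

(** In the basis of the sums and differences of the two isotropic frames the
    matrix becomes diagonal, with [k] entries of each sign. *)
Lemma inertia_swap k :
  r_neg (block_mx 0 1%:M 1%:M 0 : 'M[C]_(k + k)) = k /\
  r_pos (block_mx 0 1%:M 1%:M 0 : 'M[C]_(k + k)) = k.
Proof.
set J := block_mx _ _ _ _.
have hJ : J^t* = J by rewrite /J trC_block !trC0 !trC1.
pose G : 'M[C]_(k + k) := block_mx 1%:M 1%:M 1%:M (- 1%:M).
have hG : (2^-1 *: G) *m G = 1%:M.
  rewrite -scalemxAl /G mulmx_block !(mulmx1, mul1mx) mulmxN mulmx1 opprK subrr.
  have two p : (2^-1 : C) *: (1%:M + 1%:M) = 1%:M :> 'M[C]_p.
    by rewrite -raddfD scale_scalar_mx (_ : 1 + 1 = 2) // mulVf ?pnatr_eq0.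
  by rewrite scale_block_mx !scaler0 !two -scalar_mx_block.
have [x [y [x0 y0 e]]] : exists x y : C,
    [/\ 0 < x, y < 0 & G *m J *m G^t* = block_mx x%:M 0 0 y%:M].
  exists 2, (- 2); rewrite oppr_lt0 ltr0n; split=> //.
  have -> : G^t* = G by rewrite /G trC_block trCN trC1.
  have -> : G *m J = block_mx 1%:M 1%:M (- 1%:M) 1%:M.
    by rewrite /G /J mulmx_block !mulmx0 !mulmx1 !(add0r, addr0).
  rewrite /G mulmx_block !(mulmx1, mul1mx) subrr addNr.
  have two : (2%:M : 'M[C]_k) = 1%:M + 1%:M by rewrite -raddfD.
  by rewrite raddfN /= two opprD.
rewrite -{1}(r_neg_congr hJ hG) -(r_pos_congr hJ hG) e r_neg_block r_pos_block.
have rn a : r_neg (a%:M : 'M[C]_k) = ((a < 0)%R * k)%N by exact: count_eigenvalues_scalar.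
have rp a : r_pos (a%:M : 'M[C]_k) = ((0 < a)%R * k)%N by exact: count_eigenvalues_scalar.
rewrite (rn x) (rn y) (rp x) (rp y) x0 y0 (lt_gtF x0) (lt_gtF y0).
by rewrite mul0n mul1n addn0.
Qed.

(** The frame consists of the rows of [K] corrected by isotropic vectors, the
    isotropic vectors themselves, and the rows of [N] corrected so as to be
    isotropic too.  All these corrections move along the first block, which is
    isotropic and paired with [N] alone, so they do not change the Gram matrix
    of [K]. *)
Lemma hyperbolic_congr k n q (B : 'M[C]_(k, n)) (N : 'M[C]_(k, n)) (D : 'M[C]_n)
    (K : 'M[C]_(q, n)) (K' : 'M[C]_(n, q)) :
  D^t* = D -> N *m B^t* = 1%:M -> K *m B^t* = 0 -> K' *m K = 1%:M - B^t* *m N ->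
  exists (G : 'M[C]_(q + (k + k), k + n)) (G' : 'M[C]_(k + n, q + (k + k))),
    G' *m G = 1%:M /\
    G *m block_mx 0 B (B^t* ) D *m G^t* =
      block_mx (K *m D *m K^t* ) 0 0 (block_mx 0 1%:M 1%:M 0).
Proof.
move=> hD NB KB KK.
have BN : B *m N^t* = 1%:M by rewrite -[LHS]trmxCK trCM trmxCK NB trC1.
have BK : B *m K^t* = 0 by rewrite -[LHS]trmxCK trCM trmxCK KB trC0.
(* chosen so that the rows of [row_mx c N] are isotropic *)
pose c := - 2^-1 *: (N *m D *m N^t* ).
have hND : (N *m D *m N^t* )^t* = N *m D *m N^t* by exact: trC_congr.
have hc : c^t* = c.
  by rewrite /c trCZ hND rmorphN fmorphV rmorph_nat.
have cc : c + c + N *m D *m N^t* = 0.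
  by rewrite /c -scalerDl -{2}[N *m D *m N^t*]scale1r -scalerDl -opprD -div1r -splitr addNr scale0r.
exists (block_mx (- (K *m D *m N^t* )) K (col_mx 1%:M c) (col_mx 0 N)).
exists (block_mx 0 (row_mx 1%:M 0) K' (row_mx (K' *m K *m D *m N^t* - B^t* *m c) (B^t* ))).
split.
  rewrite mulmx_block !mul_row_col !(mul0mx, mulmx0, mul1mx, mulmx1, addr0, add0r).
  rewrite mulmxN !mulmxA subrK addNr.
  by rewrite KK subrK -scalar_mx_block.
rewrite trC_block trC_col trC_col !trC0 trC1 hc trCN !trCM trmxCK hD !mulmxA.
have e0 : col_mx 1%:M c *m 0 + col_mx 0 N *m B^t* = col_mx 0 1%:M.
  by rewrite mulmx0 add0r mul_col_mx mul0mx NB.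
have e1 : col_mx 1%:M c *m B + col_mx 0 N *m D = col_mx B (c *m B + N *m D).
  by rewrite !mul_col_mx mul0mx mul1mx add_col_mx addr0.
have e2 : (- (K *m D *m N^t* ) *m 0 + K *m B^t* ) = 0 by rewrite mulmx0 KB addr0.
rewrite 2!mulmx_block e0 e1 e2; congr block_mx.
- by rewrite mul0mx add0r mulmxDl !mulNmx -(mulmxA _ B) BK mulmx0 oppr0 add0r.
- rewrite mul0mx add0r !mul_mx_row mulmx0 mulmxDl !mulNmx.
  by rewrite -(mulmxA _ B) BN mulmx1 addNr row_mx0.
- rewrite !mul_col_mx BK mul0mx mul1mx mulmxDl -(mulmxA c) BK mulmx0 add0r.
  by rewrite add_col_mx addNr addr0 col_mx0.
- rewrite !mul_col_row !mulmx0 !mul0mx !mul1mx mulmxDl -(mulmxA c) BN mulmx1.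
  by rewrite add_block_mx !(addr0, add0r) addrA cc.
Qed.

Lemma r_neg_shift n (H : 'M[C]_n) (a : R) : H^t* = H ->
  r_neg (H - (a%:C)%:M) =
    count (fun x => x < a) [seq complex.Re x | x <- eigenvalues H].
Proof.
move=> hH; rewrite /r_neg (permP (perm_eigenvalues_shift _ hH)) !count_map.
apply: eq_in_count => x xs /=.
by rewrite {1}(eigenvalues_real hH xs) -rmorphB /= ltcR subr_lt0.
Qed.

Lemma r_pos_shift n (H : 'M[C]_n) (a : R) : H^t* = H ->
  r_pos (H - (a%:C)%:M) =
    count (fun x => a < x) [seq complex.Re x | x <- eigenvalues H].
Proof.
move=> hH; rewrite /r_pos (permP (perm_eigenvalues_shift _ hH)) !count_map.
apply: eq_in_count => x xs /=.
by rewrite {1}(eigenvalues_real hH xs) -rmorphB /= ltcR subr_gt0.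
Qed.

Definition pencil d n (T : 'M[C]_d) (b : 'M[C]_(d, n)) (M W : 'M[C]_n) (z : C) :
  'M[C]_(d + n) := block_mx (- T) b (b^t* ) (M - z *: W).

Lemma pencil_herm d n (T : 'M[C]_d) (b : 'M[C]_(d, n)) (M W : 'M[C]_n) (a : R) :
  T^t* = T -> M^t* = M -> W^t* = W ->
  (pencil T b M W a%:C)^t* = pencil T b M W a%:C.
Proof.
move=> hT hM hW; rewrite /pencil trC_block trCN trCB trCZ hT hM hW trmxCK.
have -> : Num.conj (a%:C : C) = a%:C by apply/CrealP; rewrite complex_real.
by [].
Qed.

(** Shearing by the pseudo-inverse [T'] removes the part of [b] that the
    invertible part of [T] can absorb; only [Z *m b], the component of [b] on
    the kernel of [T], survives. *)
Lemma singular_congr d n (T : 'M[C]_d) (b : 'M[C]_(d, n)) (M : 'M[C]_n)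
    (Z : 'M[C]_(r_zero T, d)) (T' : 'M[C]_d) :
  T^t* = T -> M^t* = M -> Z *m Z^t* = 1%:M -> Z *m T = 0 -> T'^t* = T' ->
  T *m T' = 1%:M - Z^t* *m Z -> T' *m T *m T' = T' ->
  exists (G : 'M[C]_(d + (r_zero T + n), d + n))
         (G' : 'M[C]_(d + n, d + (r_zero T + n))),
    G' *m G = 1%:M /\
    G *m block_mx (- T) b (b^t* ) M *m G^t* =
      block_mx (- T) 0 0
        (block_mx 0 (Z *m b) ((Z *m b)^t* ) (M + b^t* *m T' *m b)).
Proof.
move=> hT hM ZZ ZT hT' TT TTT.
have TZ : T *m Z^t* = 0 by rewrite -[LHS]trmxCK trCM trmxCK hT ZT trC0.
have TT' : T' *m T = 1%:M - Z^t* *m Z.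
  by rewrite -[LHS]trmxCK trCM hT hT' TT trCB trCM trmxCK trC1.
pose Q : 'M[C]_d := 1%:M - Z^t* *m Z.
have hQ : Q^t* = Q by rewrite /Q trCB trCM trmxCK trC1.
have QZ : Q *m Z^t* = 0 by rewrite /Q mulmxBl mul1mx -mulmxA ZZ mulmx1 subrr.
have ZQ : Z *m Q = 0 by rewrite /Q mulmxBr mulmx1 mulmxA ZZ mul1mx subrr.
have QT : Q *m T = T by rewrite /Q mulmxBl mul1mx -mulmxA ZT mulmx0 subr0.
have TQ : T *m Q = T by rewrite /Q mulmxBr mulmx1 mulmxA TZ mul0mx subr0.
have T'Q : T' *m Q = T' by rewrite /Q -TT mulmxA TTT.
have T'Z : T' *m Z^t* = 0 by rewrite -T'Q -mulmxA QZ mulmx0.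
have QQ : Q *m Q = Q by rewrite {1}/Q mulmxBl mul1mx -mulmxA ZQ mulmx0 subr0.
exists (block_mx Q 0 (col_mx Z (b^t* *m T')) (col_mx 0 1%:M)).
exists (block_mx Q (row_mx (Z^t* ) 0) (- (b^t* *m T')) (row_mx 0 1%:M)); split.
  rewrite mulmx_block !mul_row_col !(mul0mx, mulmx0, mul1mx, mulmx1, addr0, add0r) QQ.
  by rewrite /Q subrK mulNmx -mulmxA T'Q addNr -scalar_mx_block.
rewrite trC_block !trC_col !trC0 trC1 hQ [(b^t* *m T')^t* ]trCM trmxCK hT'.
have e0 : col_mx Z (b^t* *m T') *m - T + col_mx 0 1%:M *m b^t* = col_mx 0 (b^t* *m (Z^t* *m Z)).
  rewrite !mul_col_mx mul0mx mul1mx mulmxN ZT oppr0 add_col_mx addr0.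
  by rewrite mulmxN -mulmxA TT' mulmxBr mulmx1 opprB subrK.
have e1 : col_mx Z (b^t* *m T') *m b + col_mx 0 1%:M *m M = col_mx (Z *m b) (b^t* *m T' *m b + M).
  by rewrite !mul_col_mx mul0mx mul1mx add_col_mx addr0.
rewrite 2!mulmx_block e0 e1; congr block_mx.
- by rewrite mul0mx addr0 mulmx0 addr0 mulmxN mulNmx QT TQ.
- rewrite !mul0mx !addr0 mulmxN QT !mul_mx_row !mulNmx TZ mulmx0 oppr0 add_row_mx mulmx1 addr0.
  by rewrite mulmxA TT -/Q addNr row_mx0.
- by rewrite mulmx0 addr0 !mul_col_mx mul0mx -!mulmxA ZQ !mulmx0 col_mx0.
- rewrite !mul_col_row !mul0mx !mulmx0 !mulmx1 add_block_mx !(addr0, add0r).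
  rewrite trCM -!mulmxA ZZ mulmx1 (mulmxA Z).
  have -> : Z *m T' = 0 by rewrite -[LHS]trmxCK trCM hT' T'Z trC0.
  by rewrite mul0mx !mulmx0 add0r [M + _]addrC.
Qed.


Lemma posdef_congr m n (W : 'M[C]_n) (G : 'M[C]_(m, n)) : row_free G ->
  (forall u : 'rV[C]_n, u != 0 -> 0 < (u *m W *m u^t* ) 0 0) ->
  forall u : 'rV[C]_m, u != 0 -> 0 < (u *m (G *m W *m G^t* ) *m u^t* ) 0 0.
Proof.
move=> fG pW u u0; have := pW (u *m G); rewrite trCM !mulmxA; apply.
by rewrite -[0](mul0mx _ G) (inj_eq (row_free_inj fG)).
Qed.

(** After [singular_congr] and [hyperbolic_congr] the pencil is congruent to the
    direct sum of [- T], of a hyperbolic form of rank [2 * r_zero T] and of the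
    compression of [M' - a *: W] to the kernel of [Z *m b], where
    [M' = M + b^t* *m T' *m b].  The list [s] consists of the eigenvalues of this
    compression in a basis orthonormal for [W], and it does not depend on [a]. *)
Theorem pencil_spectrum d n (T : 'M[C]_d) (b : 'M[C]_(d, n)) (b' : 'M[C]_(n, d))
    (M W : 'M[C]_n) :
  T^t* = T -> M^t* = M -> W^t* = W ->
  (forall u : 'rV[C]_n, u != 0 -> 0 < (u *m W *m u^t* ) 0 0) ->
  b *m b' = 1%:M ->
  exists s : seq R, [/\ sorted <=%R s, (size s + r_zero T)%N = n,
    forall a : R, r_neg (pencil T b M W a%:C) =
      (r_pos T + r_zero T + count (fun x => (x < a)%R) s)%N &
    forall a : R, r_pos (pencil T b M W a%:C) =
      (r_neg T + r_zero T + count (fun x => (a < x)%R) s)%N].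
Proof.
move=> hT hM hW pW bb'; have [Z [T' [ZZ ZT hT' TT TTT]]] := hermitian_kernel hT.
pose B := Z *m b; pose N := (b' *m Z^t* )^t*.
have NB : N *m B^t* = 1%:M.
  by rewrite -trCM /B mulmxA -(mulmxA Z) bb' mulmx1 ZZ trC1.
pose K0 := row_base (kermx (B^t* )).
have KB0 : K0 *m B^t* = 0 by apply/sub_kermxP; rewrite eq_row_base.
have /submxP [K0' hK0'] : (1%:M - B^t* *m N <= K0)%MS.
  rewrite eq_row_base; apply/sub_kermxP.
  by rewrite mulmxBl mul1mx -mulmxA NB mulmx1 subrr.
have [G [G' [GW GG]]] := posdef_orthonormal (trC_congr K0 hW)
  (posdef_congr (row_base_free _) pW).
pose K := G *m K0; pose K' := K0' *m G'.
have KB : K *m B^t* = 0 by rewrite -mulmxA KB0 mulmx0.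
have KK : K' *m K = 1%:M - B^t* *m N.
  by rewrite /K /K' mulmxA -(mulmxA K0') GG mulmx1.
have KW : K *m W *m K^t* = 1%:M by rewrite -GW /K trCM !mulmxA.
pose M' := M + b^t* *m T' *m b.
have hM' : M'^t* = M' by rewrite /M' trCD hM !trCM trmxCK hT' mulmxA.
pose H := K *m M' *m K^t*.
have hH : H^t* = H by exact: trC_congr.
have rB : \rank (B^t* ) = r_zero T.
  apply/eqP; rewrite eqn_leq rank_leq_col /= -[X in (X <= _)%N](mxrank1 C) -NB.
  exact: mxrankM_maxr.
exists (sort <=%R [seq complex.Re x | x <- eigenvalues H]).
have key (a : R) :
    r_neg (pencil T b M W a%:C) = (r_pos T + (r_neg (H - (a%:C)%:M) + r_zero T))%N /\
    r_pos (pencil T b M W a%:C) = (r_neg T + (r_pos (H - (a%:C)%:M) + r_zero T))%N.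
  have hP := pencil_herm b a hT hM hW.
  have hMa : (M - a%:C *: W)^t* = M - a%:C *: W.
    by move: hP; rewrite /pencil trC_block => /eq_block_mx [].
  have [G1 [G1' [GG1 e1]]] := singular_congr b hT hMa ZZ ZT hT' TT TTT.
  rewrite -(r_neg_congr hP GG1) -(r_pos_congr hP GG1) e1 r_neg_block r_pos_block.
  rewrite r_negN // r_posN // -/B.
  set D := M - _ + _.
  have hD : D^t* = D by rewrite trCD hMa !trCM trmxCK hT' mulmxA.
  have hB : (block_mx 0 B (B^t* ) D)^t* = block_mx 0 B (B^t* ) D.
    by rewrite trC_block trC0 hD trmxCK.
  have [G2 [G2' [GG2 e2]]] := hyperbolic_congr hD NB KB KK.
  rewrite -(r_neg_congr hB GG2) -(r_pos_congr hB GG2) e2 r_neg_block r_pos_block.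
  have [-> ->] := inertia_swap (r_zero T).
  have -> : K *m D *m K^t* = H - (a%:C)%:M.
    rewrite /D addrAC -/M' mulmxBr mulmxBl -/H; congr (_ - _).
    by rewrite -scalemxAr -scalemxAl KW scalemx1.
  by [].
split.
- exact: sort_le_sorted.
- rewrite size_sort size_map size_eigenvalues mxrank_ker rB subnK // -rB; exact: rank_leq_row.
- move=> a; have [-> _] := key a; rewrite r_neg_shift // (permP (permEl (perm_sort _ _))) -!addnA; congr addn; exact: addnC.
- move=> a; have [_ ->] := key a; rewrite r_pos_shift // (permP (permEl (perm_sort _ _))) -!addnA; congr addn; exact: addnC.
Qed.

End Pencil.

(** * Semicontinuity of the inertia *)

Section Semicontinuity.
Local Open Scope complex_scope.
Local Open Scope sesquilinear_scope.
Context {R : realType}.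
Local Notation C := (cplx R).

(** With [N] the squared norm of [u], the form [E] is bounded on [u] by
    [max |E i j|] times the square of the sum of the [|u i|], hence by
    [r / r.+1 * N]. *)
Lemma negdef_perturb r (E : 'M[C]_r) : E^t* = E ->
  (forall i j, `|E i j| < r.+1%:R^-1) -> negdef (E - 1%:M).
Proof.
move=> hE sE u u0; rewrite mulmxBr mulmxBl mulmx1 mxE [X in _ + X]mxE subr_lt0.
pose N : C := (u *m u^t* ) 0 0; have N0 : 0 < N := normsq_gt0 u0; rewrite -/N.
have NE : N = \sum_i `|u 0 i| ^+ 2.
  by rewrite /N mxE; apply: eq_bigr => i _; rewrite !mxE normCK.
pose e : C := (u *m E *m u^t* ) 0 0; rewrite -/e.
have er : e \is Num.real.
  by apply/CrealP; rewrite /e -[in RHS](trC_congr u hE) [RHS]mxE [in RHS]mxE.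
apply: le_lt_trans (real_ler_norm er) _.
have -> : e = \sum_i \sum_j u 0 i * E i j * (u 0 j)^*%R.
  rewrite /e mxE; under eq_bigr do rewrite !mxE mulr_suml.
  by rewrite exchange_big.
have -> : N = r.+1%:R^-1 * (\sum_(i < r) N + N).
  rewrite sumr_const card_ord -mulrSr -[N *+ _]mulr_natl mulrA mulVf ?mul1r // ?pnatr_eq0.
apply: le_lt_trans (_ : _ <= r.+1%:R^-1 * (\sum_(i < r) N)) _; last first.
  by rewrite ltr_pM2l ?invr_gt0 ?ltr0n // ltrDl.
apply: le_trans (ler_norm_sum _ _ _) _.
have half : \sum_(i < r) N = \sum_(i < r) \sum_(j < r) (`|u 0 i| ^+ 2 + `|u 0 j| ^+ 2) / 2.
  under [RHS]eq_bigr do rewrite -mulr_suml big_split /= sumr_const card_ord -NE.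
  rewrite -mulr_suml big_split /= sumr_const card_ord.
  by rewrite sumrMnl -NE -mulr2n -(mulr_natr (N *+ r) 2) mulfK ?pnatr_eq0.
rewrite half mulr_sumr; apply: ler_sum => i _.
apply: le_trans (ler_norm_sum _ _ _) _.
rewrite mulr_sumr; apply: ler_sum => j _.
rewrite !normrM norm_conjC mulrAC mulrC.
apply: ler_pM; rewrite ?mulr_ge0 ?normr_ge0 //; first exact/ltW/sE.
rewrite ler_pdivlMr ?ltr0n // -subr_ge0.
have -> : `|u 0 i| ^+ 2 + `|u 0 j| ^+ 2 - `|u 0 i| * `|u 0 j| * 2 =
  (`|u 0 i| - `|u 0 j|) ^+ 2 by ring.
by rewrite real_exprn_even_ge0 // rpredB // normr_real.
Qed.

Section Cvg.
Context {X : Type} (F : set_system X) {FF : Filter F}.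

(** Entrywise convergence, along an arbitrary filter. *)
Definition mxcvg m n (f : X -> 'M[C]_(m, n)) (L : 'M[C]_(m, n)) :=
  forall i j, f x i j @[x --> F] --> L i j.

Lemma mxcvg_cst m n (L : 'M[C]_(m, n)) : mxcvg (fun=> L) L.
Proof. by move=> i j; exact: cvg_cst. Qed.

Lemma mxcvgD m n (f g : X -> 'M[C]_(m, n)) L M :
  mxcvg f L -> mxcvg g M -> mxcvg (fun x => f x + g x) (L + M).
Proof.
move=> hf hg i j; rewrite mxE; under eq_cvg do rewrite mxE.
exact: cvgD.
Qed.

Lemma mxcvgN m n (f : X -> 'M[C]_(m, n)) L :
  mxcvg f L -> mxcvg (fun x => - f x) (- L).
Proof.
move=> hf i j; rewrite mxE; under eq_cvg do rewrite mxE.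
exact: cvgN.
Qed.

Lemma mxcvg_sum (I : Type) (r : seq I) (P : pred I) m n
    (f : I -> X -> 'M[C]_(m, n)) (L : I -> 'M[C]_(m, n)) :
  (forall i, P i -> mxcvg (f i) (L i)) ->
  mxcvg (fun x => \sum_(i <- r | P i) f i x) (\sum_(i <- r | P i) L i).
Proof.
move=> h i j; rewrite summxE; under eq_cvg do rewrite summxE.
by apply: cvg_big => [|k Pk]; [exact: add_continuous|exact: h].
Qed.

Lemma mxcvgM m n p (f : X -> 'M[C]_(m, n)) (g : X -> 'M[C]_(n, p)) L M :
  mxcvg f L -> mxcvg g M -> mxcvg (fun x => f x *m g x) (L *m M).
Proof.
move=> hf hg i j; rewrite mxE; under eq_cvg do rewrite mxE.
by apply: cvg_big => [|k _]; [exact: add_continuous|exact: cvgM].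
Qed.

Lemma mxcvg_sandwich m n p q (P : 'M[C]_(m, n)) (f : X -> 'M[C]_(n, p)) L
    (Q : 'M[C]_(p, q)) :
  mxcvg f L -> mxcvg (fun x => P *m f x *m Q) (P *m L *m Q).
Proof.
move=> h; apply: mxcvgM; last exact: mxcvg_cst.
by apply: mxcvgM; [exact: mxcvg_cst|exact: h].
Qed.

Lemma mxcvg_block m1 m2 n1 n2 (f1 : X -> 'M[C]_(m1, n1)) (f2 : X -> 'M[C]_(m1, n2))
    (f3 : X -> 'M[C]_(m2, n1)) (f4 : X -> 'M[C]_(m2, n2)) L1 L2 L3 L4 :
  mxcvg f1 L1 -> mxcvg f2 L2 -> mxcvg f3 L3 -> mxcvg f4 L4 ->
  mxcvg (fun x => block_mx (f1 x) (f2 x) (f3 x) (f4 x)) (block_mx L1 L2 L3 L4).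
Proof.
move=> h1 h2 h3 h4 i j.
case: (split_ordP i) => i' ->; case: (split_ordP j) => j' ->.
- rewrite block_mxEul; under eq_cvg do rewrite block_mxEul.
  exact: h1.
- rewrite block_mxEur; under eq_cvg do rewrite block_mxEur.
  exact: h2.
- rewrite block_mxEdl; under eq_cvg do rewrite block_mxEdl.
  exact: h3.
- rewrite block_mxEdr; under eq_cvg do rewrite block_mxEdr.
  exact: h4.
Qed.

Lemma cvg_det n (f : X -> 'M[C]_n) L :
  mxcvg f L -> \det (f x) @[x --> F] --> \det L.
Proof.
move=> h; apply: cvg_big => [|s _]; first exact: add_continuous.
apply: cvgM; first exact: cvg_cst.
by apply: cvg_big => [|k _]; [exact: mul_continuous|exact: h].
Qed.

(** Cramer's rule. *)
Lemma mxcvg_invmx n (f : X -> 'M[C]_n) L :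
  mxcvg f L -> L \in unitmx -> (\forall x \near F, f x \in unitmx) ->
  mxcvg (fun x => invmx (f x)) (invmx L).
Proof.
move=> h uL uf i j.
have -> : invmx L i j = (\det L)^-1 * cofactor L j i by rewrite /invmx uL !mxE.
apply: cvg_trans (_ : ((\det (f x))^-1 * cofactor (f x) j i) @[x --> F] --> _).
  apply: near_eq_cvg; near=> x.
  have ux : f x \in unitmx by near: x.
  by rewrite /invmx ux !mxE.
apply: cvgM.
  by apply: cvgV; [move: uL; rewrite unitmxE unitfE|exact: cvg_det].
apply: cvgM; first exact: cvg_cst.
apply: cvg_det => i' j'; rewrite !mxE; under eq_cvg do rewrite !mxE.
exact: h.
Unshelve. all: by end_near. Qed.

(** A Gram matrix equal to [- 1%:M] stays negative definite under small
    perturbations. *)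
Lemma r_neg_lsc n (f : X -> 'M[C]_n) L :
  L^t* = L -> mxcvg f L -> (\forall x \near F, (f x)^t* = f x) ->
  \forall x \near F, (r_neg L <= r_neg (f x))%N.
Proof.
move=> hL h hf; have [V hV] := r_neg_witness hL.
set r := r_neg L in V hV *.
have hg : mxcvg (fun x => V *m f x *m V^t* ) (- 1%:M).
  by rewrite -hV; exact: mxcvg_sandwich.
have near1 : \forall x \near F, forall i j,
    `|(V *m f x *m V^t* + 1%:M) i j| < r.+1%:R^-1.
  apply: filter_forall => i; apply: filter_forall => j.
  have /cvgr_dist_lt /(_ (r.+1%:R^-1 : C)) := hg i j.
  rewrite invr_gt0 ltr0n => /(_ isT); apply: filterS => x.
  by rewrite !mxE distrC opprK.
near=> x; have hx : (f x)^t* = f x by near: x.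
apply: (r_neg_ge (V := V)) => //.
rewrite -[V *m _ *m _](addrK 1%:M); apply: negdef_perturb; last by near: x.
by rewrite trCD trC1 trC_congr.
Unshelve. all: by end_near. Qed.

Lemma r_pos_lsc n (f : X -> 'M[C]_n) L :
  L^t* = L -> mxcvg f L -> (\forall x \near F, (f x)^t* = f x) ->
  \forall x \near F, (r_pos L <= r_pos (f x))%N.
Proof.
move=> hL h hf.
have hN : \forall x \near F, (- f x)^t* = - f x.
  by apply: filterS hf => x hx; rewrite trCN hx.
have := r_neg_lsc _ (mxcvgN h) hN; rewrite trCN hL => /(_ erefl).
by apply: filterS2 hf => x hx; rewrite !r_negN.
Qed.

(** [r_pos] and [r_neg] can only increase near the limit, and their sum is
    prevented from increasing by the nullity. *)
Lemma r_neg_locally_constant n (f : X -> 'M[C]_n) L :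
  L^t* = L -> mxcvg f L -> (\forall x \near F, (f x)^t* = f x) ->
  (\forall x \near F, (r_zero L <= r_zero (f x))%N) ->
  \forall x \near F, r_neg (f x) = r_neg L.
Proof.
move=> hL h hf h0; near=> x.
have hx : (f x)^t* = f x by near: x.
have := inertia_sum hL; have := inertia_sum hx.
have : (r_zero L <= r_zero (f x))%N by near: x.
have : (r_neg L <= r_neg (f x))%N by near: x; exact: r_neg_lsc.
have : (r_pos L <= r_pos (f x))%N by near: x; exact: r_pos_lsc.
lia.
Unshelve. all: by end_near. Qed.

End Cvg.
End Semicontinuity.

(** * Boundary conditions as graphs *)

Lemma mul_block_diag (K : pzRingType) m1 m2 n1 n2 (a : 'M[K]_(m1, n1))
    (b : 'M[K]_(m1, n2)) (c : 'M[K]_(m2, n1)) (e : 'M[K]_(m2, n2)) k1 k2 (p : 'M[K]_(n1, k1)) (q : 'M[K]_(n2, k2)) :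
  block_mx a b c e *m block_mx p 0 0 q =
  row_mx (col_mx (a *m p) (c *m p)) (col_mx (b *m q) (e *m q)).
Proof. by rewrite mulmx_block !mulmx0 !addr0 !add0r block_mxEh. Qed.


Section BoundaryAlgebra.
Local Open Scope complex_scope.
Local Open Scope sesquilinear_scope.
Context {R : realType} {d k : nat}.
Local Notation C := (cplx R).
Variables (E1 E2 S1 S2 S3 : 'M[C]_d) (E0 : 'M[C]_(d, k)).

Lemma row_mx_chart :
  row_mx (block_mx S1 S2 (S2^t* ) S3) 1%:M *m
    block_mx (block_mx E1 0 0 E2) (block_mx (1%:M - E1) 0 0 (1%:M - E2))
             (block_mx (E1 - 1%:M) 0 0 (E2 - 1%:M)) (block_mx E1 0 0 E2) =
  row_mx (row_mx (col_mx (S1 *m E1 + E1 - 1%:M) (S2^t* *m E1))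
                 (col_mx (S2 *m E2) (S3 *m E2 + E2 - 1%:M)))
         (row_mx (col_mx (S1 *m (1%:M - E1) + E1) (S2^t* *m (1%:M - E1)))
                 (col_mx (S2 *m (1%:M - E2)) (S3 *m (1%:M - E2) + E2))).
Proof.
rewrite mul_row_block !mul1mx !mul_block_diag !block_mxEh.
by congr row_mx; rewrite add_row_mx !add_col_mx !addr0 ?addrA.
Qed.

Hypotheses (h1 : E1^t* = E1) (i1 : E1 *m E1 = E1).
Hypotheses (E0E0 : E0^t* *m E0 = 1%:M) (E0C : E0 *m E0^t* = 1%:M - E2).
Hypotheses (hS1 : S1^t* = S1).
Variables (RR : 'M[C]_d) (T1 : 'M[C]_(d, k)) (T2 : 'M[C]_k) (J : 'M[C]_d).
Hypotheses (RE : RR = S1 *m E1 + E1 - 1%:M) (uR : RR \in unitmx).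
Hypotheses (JE : J = S2^t* *m E1 *m invmx RR *m S2 - S3).
Hypotheses (T2E : T2 = E0^t* *m J *m E0) (uT : T2 \in unitmx).
Hypotheses (T1E : T1 = invmx RR *m S2 *m E0).

Let E2E : E2 = 1%:M - E0 *m E0^t*.
Proof. by rewrite E0C opprB addrC subrK. Qed.

(** The Schur complement of [RR] is [E2 - J *m E0 *m E0^t*], whose only
    nontrivial part is its compression [- T2] to the range of [E0]. *)
Lemma chart_lhs_unit :
  block_mx RR (S2 *m (1%:M - E2)) (S2^t* *m E1) (S3 *m (1%:M - E2) + E2) \in unitmx.
Proof.
pose Dm : 'M[C]_d := E2 - J *m (1%:M - E2).
have -> : block_mx RR (S2 *m (1%:M - E2)) (S2^t* *m E1) (S3 *m (1%:M - E2) + E2) =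
          block_mx 1%:M 0 (S2^t* *m E1 *m invmx RR) 1%:M *m
                  block_mx RR (S2 *m (1%:M - E2)) 0 Dm.
  rewrite mulmx_block !mul1mx !mul0mx !addr0 mulmxKV //.
  congr block_mx; rewrite /Dm JE [in RHS]mulmxBl opprB !mulmxA addrC.
  by rewrite [RHS]addrC -!addrA addNr addr0.
(* the inverse of [Dm] is [E2 *m Y - Z] *)
pose Z : 'M[C]_d := E0 *m invmx T2 *m E0^t*.
pose Y : 'M[C]_d := 1%:M - J *m Z.
have JZ : E0^t* *m (J *m Z) = E0^t*.
  by rewrite /Z !mulmxA -T2E mulmxV // mul1mx.
suff DY : Dm *m (E2 *m Y - Z) = 1%:M.
  have [uD _] := mulmx1_unit DY.
  rewrite unitmx_mul !unitmxE det_lblock det_ublock !det1 mulr1 unitr1 /=.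
  by rewrite unitrM -!unitmxE uR.
have EZ : E0 *m E0^t* *m Z = Z by rewrite /Z !mulmxA -(mulmxA E0) E0E0 mulmx1.
have EY : E0 *m E0^t* *m Y = 0.
  by rewrite /Y mulmxBr mulmx1 -mulmxA JZ subrr.
have E2Z : E2 *m Z = 0 by rewrite E2E mulmxBl mul1mx EZ subrr.
have E2Y : E2 *m Y = Y by rewrite E2E mulmxBl mul1mx EY subr0.
rewrite E2Y /Dm -E0C mulmxBl mulmxBr E2Y E2Z subr0 -mulmxA mulmxBr EY EZ sub0r.
by rewrite mulmxN opprK /Y subrK.
Qed.

Let X : 'M[C]_d := invmx RR *m (S1 *m (1%:M - E1) + E1).

(** The Hermitian matrix [S1] enters [RR] through [S1 *m E1] only, which gives
    [RR^t* *m E1 = E1 *m RR]; this carries [E1] across the inverse of [RR]. *)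
Lemma chart_E1_mul : E1 *m X = 1%:M - E1 + (invmx RR)^t*.
Proof.
have uRC : (invmx RR)^t* *m RR^t* = 1%:M by rewrite -trCM mulmxV // trC1.
have hR : RR^t* = E1 *m S1 + E1 - 1%:M by rewrite RE trCB trCD trCM trC1 h1 hS1.
have comm : RR^t* *m E1 = E1 *m RR.
  by rewrite hR RE mulmxBr mulmxBl mulmxDl mulmxDr mul1mx mulmx1 !i1 mulmxA !addrK.
rewrite -[LHS]mul1mx -uRC -mulmxA (mulmxA _ E1) comm -(mulmxA E1) mulKVmx //.
have -> : E1 *m (S1 *m (1%:M - E1) + E1) = RR^t* *m (1%:M - E1) + 1%:M.
  rewrite hR mulmxDr i1 mulmxBl mulmxDl mul1mx !mulmxA.
  rewrite [E1 *m (1%:M - E1)]mulmxBr mulmx1 i1 subrr addr0.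
  by rewrite opprB -!addrA addNr addr0.
by rewrite mulmxDr mulmx1 mulmxA uRC mul1mx.
Qed.

(** Solving the linear system that defines the first block column of the graph:
    the upper half of the solution is the part of [Tmx] that does not
    depend on [P_0], which is where the formula for [Tmx] comes from. *)
Lemma chart_solve : exists C21 : 'M[C]_d,
  block_mx RR (S2 *m (1%:M - E2)) (S2^t* *m E1) (S3 *m (1%:M - E2) + E2) *m
    col_mx (X - T1 *m invmx T2 *m T1^t* ) C21 =
  col_mx (S1 *m (1%:M - E1) + E1) (S2^t* *m (1%:M - E1)).
Proof.
pose Y : 'M[C]_(k, d) := invmx T2 *m T1^t*.
pose C21 : 'M[C]_d := E0 *m Y - S2^t* *m (invmx RR)^t* + J *m E0 *m Y.
have RT1 : RR *m T1 = S2 *m E0 by rewrite T1E -mulmxA mulKVmx.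
have T2Y : T2 *m Y = T1^t* by rewrite mulKVmx.
have E0C21 : E0^t* *m C21 = Y.
  rewrite /C21 mulmxDr mulmxBr (mulmxA _ E0 Y) E0E0 mul1mx.
  rewrite [E0^t* *m (J *m E0 *m Y)]mulmxA [E0^t* *m (J *m E0)]mulmxA -T2E T2Y.
  by rewrite T1E !trCM !mulmxA subrK.
have E2C21 : E2 *m C21 = - (S2^t* *m (invmx RR)^t* ) + J *m E0 *m Y.
  by rewrite E2E mulmxBl mul1mx -(mulmxA E0 (E0^t* )) E0C21 /C21 addrC !addrA addNr add0r.
exists C21; rewrite -(mulmxA T1) -/Y mul_block_col; congr col_mx.
  rewrite mulmxBr mulKVmx // mulmxA RT1 -E0C -!mulmxA E0C21.
  by rewrite subrK.
have JY : J *m E0 *m Y = S2^t* *m (E1 *m T1 *m Y) - S3 *m (E0 *m Y).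
  by rewrite JE T1E !mulmxBl !mulmxA.
rewrite mulmxDl E2C21 -E0C -(mulmxA S3) -(mulmxA E0) E0C21 JY.
rewrite -(mulmxA _ E1) (mulmxBr E1) chart_E1_mul (mulmxA E1) mulmxBr (mulmxDr _ (1%:M - E1)).
have cancel (p a b c : 'M[C]_d) : p + a - b + (c + (- a + (b - c))) = p.
  by rewrite (addrCA c) (addrC c) subrK (addrC (- a)) addrA subrK addrK.
exact: cancel.
Qed.

End BoundaryAlgebra.

Section LagrangianGraph.
Local Open Scope complex_scope.
Local Open Scope sesquilinear_scope.
Context {R : realType} {d : nat}.
Local Notation C := (cplx R).
Variables (G D : 'M[C]_(d + d)).
Hypothesis uG : G \in unitmx.

(** With [s = diag (1, -1)] the hypothesis reads [D *m s] Hermitian, once the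
    invertible [G] is cancelled on both sides. *)
Lemma lagrangian_graph (s := block_mx 1%:M 0 0 (- 1%:M) : 'M[C]_(d + d)) :
  G *m s *m (G *m D)^t* = G *m D *m s *m G^t* ->
  [/\ (ulsubmx D)^t* = ulsubmx D, (drsubmx D)^t* = drsubmx D &
      dlsubmx D = - (ursubmx D)^t*].
Proof.
have uG' : G^t* \in unitmx by rewrite map_unitmx unitmx_tr.
rewrite trCM mulmxA => /(congr1 (mulmx^~ (invmx (G^t* )))); rewrite /= !mulmxK //.
rewrite -!(mulmxA G) => /(congr1 (mulmx (invmx G))); rewrite !mulKmx //.
rewrite -{1 2}(submxK D) trC_block /s !mulmx_block.
rewrite !(mul1mx, mulmx1, mul0mx, mulmx0, addr0, add0r) !mulNmx !mulmxN !mul1mx !mulmx1.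
by case/eq_block_mx => h1 h2 h3 h4; split=> //; exact: oppr_inj.
Qed.

Lemma graph_solved (u1 v2 v1 u2 : 'cV[C]_d) :
  G *m (col_mx u1 v2 + D *m col_mx v1 u2) = 0 <->
  u1 = - (ulsubmx D *m v1 + ursubmx D *m u2) /\
  v2 = - (dlsubmx D *m v1 + drsubmx D *m u2).
Proof.
rewrite -{1}(submxK D) mul_block_col add_col_mx; split.
  move/(congr1 (mulmx (invmx G))); rewrite mulKmx // mulmx0.
  rewrite -[0]vsubmxK !linear0 => /eq_col_mx [h1 h2].
  by split; apply/eqP; rewrite -addr_eq0 ?h1 ?h2.
move=> [e1 e2]; set x := _ + _; set y := _ + _.
have -> : x = 0 by apply/eqP; rewrite addr_eq0 e1.
have -> : y = 0 by apply/eqP; rewrite addr_eq0 e2.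
by rewrite col_mx0 mulmx0.
Qed.

End LagrangianGraph.

Section Boundary.
Local Open Scope complex_scope.
Local Open Scope sesquilinear_scope.
Context {R : realType} {d : nat}.
Local Notation C := (cplx R).
Variables (K : {set 'I_(d + d)}) (S : 'M[C]_(d + d)).
Hypothesis hS : S^t* = S.

Let E1 : 'M[C]_d := E_1 K.
Let E2 : 'M[C]_d := E_2 K.
Let E0 : 'M[C]_(d, #|K_2 K|) := E_0 K.
Let S1 : 'M[C]_d := ulsubmx S.
Let S2 : 'M[C]_d := ursubmx S.
Let S3 : 'M[C]_d := drsubmx S.

Lemma S_block : S = block_mx S1 S2 (S2^t* ) S3 /\ S1^t* = S1.
Proof.
have := hS; rewrite -{1}(submxK S) trC_block -{5}(submxK S).
by case/eq_block_mx => h1 _ h3 _; rewrite /S1 /S2 /S3 h1 h3 submxK.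
Qed.

Lemma E1_proj : E1^t* = E1 /\ E1 *m E1 = E1.
Proof. exact: diag01_trC. Qed.

Lemma E0_isometry : E0^t* *m E0 = 1%:M.
Proof.
apply/matrixP => i j; rewrite !mxE (bigD1 (enum_val i)) //= big1 => [|k ki].
  by rewrite !mxE eqxx rmorph1 mul1r addr0 (inj_eq enum_val_inj).
by rewrite !mxE (negbTE ki) rmorph0 mul0r.
Qed.

Lemma E0_range : E0 *m E0^t* = 1%:M - E2.
Proof.
apply/matrixP => i j; rewrite !mxE.
have [iK|iK] := boolP (i \in K_2 K).
  rewrite mul0rn subr0 (bigD1 (enum_rank_in iK i)) //= big1 => [|k kj].
    by rewrite !mxE enum_rankK_in // eqxx mul1r addr0 rmorph_nat eq_sym.
  rewrite !mxE -[i in (i == _)%:R](enum_rankK_in iK iK) (inj_eq enum_val_inj).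
  by rewrite eq_sym (negbTE kj) mul0r.
rewrite subrr big1 // => k _; rewrite !mxE.
case: eqP => [ik|_]; last by rewrite mul0r.
by case/negP: iK; rewrite ik; exact: enum_valP.
Qed.

Let RR : 'M[C]_d := Rmx K S.

Lemma chart_blocks : chart_mx K S =
  row_mx (row_mx (col_mx RR (S2^t* *m E1)) (col_mx (S2 *m E2) (S3 *m E2 + E2 - 1%:M)))
         (row_mx (col_mx (S1 *m (1%:M - E1) + E1) (S2^t* *m (1%:M - E1)))
                 (col_mx (S2 *m (1%:M - E2)) (S3 *m (1%:M - E2) + E2))).
Proof.
have [eS _] := S_block.
rewrite {1}eS; exact: row_mx_chart.
Qed.

Hypothesis hnd : nondegeneracy K S.

Let uR : RR \in unitmx. Proof. by case: hnd. Qed.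

Let T1 : 'M[C]_(d, #|K_2 K|) := That_1 K S.
Let T2 : 'M[C]_#|K_2 K| := That_2 K S.

(** For empty [K_2] this is a matrix without rows, so the two cases of the
    definition of [Tmx] need not be distinguished. *)
Lemma That_2_unit : T2 \in unitmx.
Proof.
have [_ h] := hnd; have [e|] := eqVneq (K_2 K) finset.set0; last exact: h.
rewrite unitmxE; move: T2; rewrite e cards0 => T; rewrite det_mx00; exact: unitr1.
Qed.

(** (A_1, B_2), the coefficients of u_1 and v_2 in the boundary condition. *)
Definition bc_lhs : 'M[C]_(d + d) :=
  row_mx (lsubmx (lsubmx (chart_mx K S))) (rsubmx (rsubmx (chart_mx K S))).
(** (B_1, A_2), the coefficients of v_1 and u_2. *)
Definition bc_rhs : 'M[C]_(d + d) :=
  row_mx (lsubmx (rsubmx (chart_mx K S))) (rsubmx (lsubmx (chart_mx K S))).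

Let J : 'M[C]_d := S2^t* *m E1 *m invmx RR *m S2 - S3.

Lemma bc_lhsE : bc_lhs =
  block_mx RR (S2 *m (1%:M - E2)) (S2^t* *m E1) (S3 *m (1%:M - E2) + E2).
Proof. by rewrite /bc_lhs chart_blocks !(row_mxKl, row_mxKr) block_mxEh. Qed.

Lemma bc_rhsE : bc_rhs =
  block_mx (S1 *m (1%:M - E1) + E1) (S2 *m E2)
           (S2^t* *m (1%:M - E1)) (S3 *m E2 + E2 - 1%:M).
Proof. by rewrite /bc_rhs chart_blocks !(row_mxKl, row_mxKr) block_mxEh. Qed.

Lemma bc_lhs_unit : bc_lhs \in unitmx.
Proof.
rewrite bc_lhsE.
exact: (@chart_lhs_unit _ _ _ E1 E2 S2 S3 E0 E0_isometry E0_range RR T2 J uR erefl erefl That_2_unit).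
Qed.

(** The boundary condition is the graph (u_1, v_2) = - [bc_mx] (v_1, u_2). *)
Definition bc_mx : 'M[C]_(d + d) := invmx bc_lhs *m bc_rhs.

Lemma bc_mxE : bc_lhs *m bc_mx = bc_rhs.
Proof. by rewrite mulKVmx // bc_lhs_unit. Qed.


Let X : 'M[C]_d := invmx RR *m (S1 *m (1%:M - E1) + E1).

Lemma bc_mx_ul : ulsubmx bc_mx = X - T1 *m invmx T2 *m T1^t*.
Proof.
have [h1 i1] := E1_proj; have [_ hS1] := S_block.
have [C21 h] := @chart_solve _ _ _ E1 E2 S1 S2 S3 E0 h1 i1 E0_isometry E0_range hS1
  RR T1 T2 J erefl uR erefl erefl That_2_unit erefl.
have e : lsubmx bc_mx = col_mx (X - T1 *m invmx T2 *m T1^t* ) C21.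
  rewrite /bc_mx -mulmx_lsub bc_rhsE block_mxEh row_mxKl -[in LHS]h -bc_lhsE mulKmx //.
  exact: bc_lhs_unit.
move: e; rewrite -{1}(submxK bc_mx) block_mxEh row_mxKl.
by case/eq_col_mx.
Qed.

Lemma TmxE N (om : coefs R d N) : Tmx K S om = Pinv om ord0 + ulsubmx bc_mx.
Proof.
rewrite bc_mx_ul /Tmx -/RR -/T1 -/T2 -/S1 -/E1 -/X addrA; congr (_ - _).
case: eqP => // e.
suff -> : T1 = 0 by rewrite !mul0mx.
by apply/matrixP => i j; have := ltn_ord j; rewrite {2}e cards0.
Qed.

Lemma chart_lagrangian :
  lsubmx (chart_mx K S) *m (rsubmx (chart_mx K S))^t* =
  rsubmx (chart_mx K S) *m (lsubmx (chart_mx K S))^t*.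
Proof.
have : calO K (bclass (chart_mx K S)) by exists S => //; exact/hermitianP.
move/calO_sub_calB => [A [B [_ AB e]]].
have : bclass (chart_mx K S) (chart_mx K S).
  by exists 1%:M; [exact: unitmx1|rewrite mul1mx].
rewrite e => -[G _ <-]; rewrite mul_mx_row row_mxKl row_mxKr !trCM !mulmxA.
by rewrite -!(mulmxA G) AB.
Qed.

Lemma bc_mx_herm : [/\ (ulsubmx bc_mx)^t* = ulsubmx bc_mx,
  (drsubmx bc_mx)^t* = drsubmx bc_mx & dlsubmx bc_mx = - (ursubmx bc_mx)^t*].
Proof.
pose s : 'M[C]_(d + d) := block_mx 1%:M 0 0 (- 1%:M).
have uG := bc_lhs_unit.
have : bc_lhs *m s *m bc_rhs^t* = bc_rhs *m s *m bc_lhs^t*.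
  have := chart_lagrangian.
  set A := lsubmx _; set B := rsubmx _.
  move=> AB.
  have h : lsubmx A *m (lsubmx B)^t* + rsubmx A *m (rsubmx B)^t* =
      lsubmx B *m (lsubmx A)^t* + rsubmx B *m (rsubmx A)^t*.
    by rewrite -!mul_row_col -!trC_row !hsubmxK.
  rewrite /bc_lhs /bc_rhs -/A -/B !trC_row !mul_row_block !(mulmx0, mulmx1, addr0, add0r).
  rewrite !mulmxN !mulmx1 !mul_row_col !mulNmx; apply/eqP.
  by rewrite subr_eq addrAC eq_sym subr_eq eq_sym h addrC.
by rewrite -bc_mxE; exact: lagrangian_graph.
Qed.

Lemma bc_solved (u1 u2 v1 v2 : 'cV[C]_d) :
  lsubmx (chart_mx K S) *m col_mx u1 u2 + rsubmx (chart_mx K S) *m col_mx v1 v2 = 0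
  <-> u1 = - (ulsubmx bc_mx *m v1 + ursubmx bc_mx *m u2) /\
      v2 = - (dlsubmx bc_mx *m v1 + drsubmx bc_mx *m u2).
Proof.
have -> : lsubmx (chart_mx K S) *m col_mx u1 u2 + rsubmx (chart_mx K S) *m col_mx v1 v2
    = bc_lhs *m (col_mx u1 v2 + bc_mx *m col_mx v1 u2).
  rewrite mulmxDr mulmxA bc_mxE /bc_lhs /bc_rhs.
  rewrite -{1}(hsubmxK (lsubmx (chart_mx K S))) -{1}(hsubmxK (rsubmx (chart_mx K S))).
  rewrite !mul_row_col [X in _ + X = _]addrC addrACA; congr (_ + _).
  exact: addrC.
exact: graph_solved bc_lhs_unit _ _ _ _.
Qed.

Lemma Tmx_herm N (om : coefs R d N) : Omega om -> (Tmx K S om)^t* = Tmx K S om.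
Proof.
case=> hP _ _; have [/hermitianP h _] := hP ord0; have [h1 _ _] := bc_mx_herm.
by rewrite TmxE trCD h h1.
Qed.

(** [Fmx] is the product of [bc_lhs] and of a block triangular matrix with
    diagonal blocks [Tmx] and 1. *)
Lemma nullity_r_zero N (om : coefs R d N) : Omega om ->
  nullity K S om = r_zero (Tmx K S om).
Proof.
move=> hom; have hT := Tmx_herm hom.
have e : Fmx K S om = bc_lhs *m (block_mx (Tmx K S om) 0 0 1%:M *m
    block_mx 1%:M 0 (dlsubmx bc_mx) 1%:M).
  rewrite mulmx_block !mulmx1 !mul1mx !mul0mx !mulmx0 !addr0 !add0r TmxE /Fmx.
  have := bc_mxE; rewrite -{1}(submxK bc_mx) /bc_lhs /bc_rhs mul_row_block => /eq_row_mx [h _].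
  rewrite mul_row_block mulmx0 mulmx1 add0r mulmxDr; congr row_mx.
  by rewrite -addrA; congr (_ + _); rewrite -h.
have rF : \rank (Fmx K S om) = (\rank (Tmx K S om) + d)%N.
  rewrite e (eqmxMfull _ _) ?row_full_unit ?bc_lhs_unit // mxrankMfree; last first.
    by rewrite row_free_unit unitmxE det_lblock !det1 mulr1 unitr1.
  by rewrite rank_diag_block_mx mxrank1.
by rewrite /nullity rF -{1}(rank_r_zero hT); lia.
Qed.

Lemma bclass_cond (u v : 'cV[C]_(d + d)) :
  (forall M, bclass (chart_mx K S) M -> lsubmx M *m u + rsubmx M *m v = 0) <->
  lsubmx (chart_mx K S) *m u + rsubmx (chart_mx K S) *m v = 0.
Proof.
split=> [h|h M [G _ <-]].
  by apply: h; exists 1%:M; [exact: unitmx1|rewrite mul1mx].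
rewrite -[chart_mx K S]hsubmxK mul_mx_row row_mxKl row_mxKr -!mulmxA -mulmxDr.
by rewrite h mulmx0.
Qed.

End Boundary.

(** * Reduction of the difference problem to a pencil *)

Section Blocks.
Local Open Scope complex_scope.
Local Open Scope sesquilinear_scope.
Context {R : realType} {d N' : nat}.
Local Notation C := (cplx R).
Local Notation N := N'.+2.

(** The projection of a vector (y_1, .., y_N) to its component of index i + 1;
    these matrices make up a resolution of the identity ([blkK], [blk_sum]). *)
Definition blk (i : 'I_N) : 'M[C]_(d, N * d) :=
  \matrix_(a, c) (c == mxvec_index i a)%:R.

Lemma mxvec_index_eq (i j : 'I_N) (a b : 'I_d) :
  (mxvec_index i a == mxvec_index j b) = (i == j) && (a == b).
Proof.
by rewrite /mxvec_index (inj_eq (@cast_ord_inj _ _ _)) (inj_eq enum_rank_inj).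
Qed.

Lemma blkK (i j : 'I_N) : blk i *m (blk j)^t* = ((i == j)%:R)%:M.
Proof.
apply/matrixP => a b; rewrite !mxE (bigD1 (mxvec_index i a)) //= big1 => [|c hc].
  by rewrite !mxE eqxx mul1r addr0 rmorph_nat mxvec_index_eq; do 2 case: eqP.
by rewrite !mxE (negbTE hc) mul0r.
Qed.

Lemma blk_sum : \sum_i (blk i)^t* *m blk i = 1%:M.
Proof.
apply/matrixP => c e; rewrite summxE mxE.
case/mxvec_indexP: c => i a; case/mxvec_indexP: e => j b.
rewrite (bigD1 i) //= big1 => [|k ki]; last first.
  rewrite mxE big1 // => l _; rewrite !mxE mxvec_index_eq [i == k]eq_sym (negbTE ki).
  by rewrite rmorph0 mul0r.
rewrite addr0 mxE (bigD1 a) //= big1 => [|l la]; last first.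
  by rewrite !mxE mxvec_index_eq [a == l]eq_sym (negbTE la) andbF rmorph0 mul0r.
by rewrite !mxE !mxvec_index_eq !eqxx rmorph1 mul1r addr0 [j == i]eq_sym [b == a]eq_sym.
Qed.

Lemma blk_eq0 p (V : 'M[C]_(N * d, p)) : (forall i, blk i *m V = 0) -> V = 0.
Proof.
move=> h; rewrite -[V]mul1mx -blk_sum mulmx_suml big1 // => i _.
by rewrite -mulmxA h mulmx0.
Qed.

Definition stack (y : 'I_N -> 'cV[C]_d) : 'cV[C]_(N * d) :=
  \sum_i (blk i)^t* *m y i.

Lemma blk_stack y i : blk i *m stack y = y i.
Proof.
rewrite /stack mulmx_sumr (bigD1 i) //= big1 => [|k ki].
  by rewrite mulmxA blkK eqxx mul1mx addr0.
by rewrite mulmxA blkK eq_sym (negbTE ki) mul_scalar_mx scale0r.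
Qed.

Lemma stack_blk (Y : 'cV[C]_(N * d)) : stack (fun i => blk i *m Y) = Y.
Proof.
rewrite /stack; under eq_bigr do rewrite mulmxA.
by rewrite -mulmx_suml blk_sum mul1mx.
Qed.

Variables (K : {set 'I_(d + d)}) (S : 'M[C]_(d + d)).
Let C12 : 'M[C]_d := ursubmx (bc_mx K S).
Let C22 : 'M[C]_d := drsubmx (bc_mx K S).

Definition step (k : nat) : 'M[C]_(d, N * d) := blk (inord k.+1) - blk (inord k).

(** The quadratic form of the difference operator, summed by parts: potential
    energy, interior fluxes, and the contribution of the right end that the
    boundary condition expresses through y_N. *)
Definition stiffness (om : coefs R d N) : 'M[C]_(N * d) :=
  \sum_i (blk i)^t* *m Qmx om i *m blk i
  + \sum_(k < N'.+1) (step k)^t* *m Pmx om (inord k.+1) *m step k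
  + (blk ord_max)^t* *m C22 *m blk ord_max.

Definition weight (om : coefs R d N) : 'M[C]_(N * d) :=
  \sum_i (blk i)^t* *m Wmx om i *m blk i.

(** y_1 - C12 y_N, where C12 is the upper right block of [bc_mx]. *)
Definition coupling : 'M[C]_(d, N * d) := blk ord0 - C12 *m blk ord_max.

Definition sl_pencil (om : coefs R d N) (z : C) : 'M[C]_(d + N * d) :=
  pencil (Tmx K S om) coupling (stiffness om) (weight om) z.

Lemma coupling_onto : coupling *m (blk ord0)^t* = 1%:M.
Proof. by rewrite mulmxBl -mulmxA !blkK eqxx mul_mx_scalar scale0r subr0. Qed.

(** P_j Delta y_j as a function of x_0 and y_1, .., y_N: the values at the two
    ends are given by x_0 and by the boundary condition. *)
Definition flux (om : coefs R d N) (x0 : 'cV[C]_d) (Y : 'cV[C]_(N * d)) (j : nat) :=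
  if j == 0%N then x0 else
  if j == N then C12^t* *m x0 - C22 *m (blk ord_max *m Y)
  else Pmx om (inord j) *m (step j.-1 *m Y).

Lemma blk_step (i : 'I_N) (k : 'I_N'.+1) :
  blk i *m (step k)^t* = ((i == k.+1 :> nat)%:R - (i == k :> nat)%:R)%:M.
Proof.
have h1 : (inord k.+1 : 'I_N) = k.+1 :> nat by rewrite inordK // ltnS.
have h2 : (inord k : 'I_N) = k :> nat by rewrite inordK // ltnW // ltnS.
by rewrite /step trCB mulmxBr !blkK raddfB -!val_eqE /= h1 h2.
Qed.

Lemma sum_step (i : 'I_N) (g : nat -> 'cV[C]_d) :
  \sum_(k < N'.+1) ((i == k.+1 :> nat)%:R - (i == k :> nat)%:R) *: g k =
  (if i == 0%N :> nat then 0 else g i.-1) - (if i == N'.+1 :> nat then 0 else g i).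
Proof.
under eq_bigr do rewrite scalerBl.
rewrite sumrB; congr (_ - _).
  case: i => -[|i] hi /=; first by rewrite big1 // => k _; rewrite scale0r.
  rewrite (bigD1 (Ordinal (hi : (i < N'.+1)%N))) //= big1 => [|k ki].
    by rewrite eqxx scale1r addr0.
  by have := ki; rewrite -val_eqE /= eqSS eq_sym => /negbTE ->; rewrite scale0r.
have [e|ne] := eqVneq (i : nat) N'.+1.
  by rewrite big1 // => k _; rewrite e gtn_eqF // scale0r.
have hi : (i < N'.+1)%N by have := ltn_ord i; rewrite ltnS leq_eqVlt (negbTE ne).
rewrite (bigD1 (Ordinal hi)) //= big1 => [|k ki]; first by rewrite eqxx scale1r addr0.
by have := ki; rewrite -val_eqE /= eq_sym => /negbTE ->; rewrite scale0r.
Qed.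

(** Row i of the pencil is the difference equation with index i + 1. *)
Lemma sl_row om z x0 Y (i : 'I_N) :
  blk i *m (coupling^t* *m x0 + (stiffness om - z *: weight om) *m Y) =
  flux om x0 Y i - flux om x0 Y i.+1 + Qmx om i *m (blk i *m Y)
  - z *: (Wmx om i *m (blk i *m Y)).
Proof.
have z1 (x c q e : 'cV[C]_d) : x - c + (q + e) = x - (c - e) + q.
  by rewrite opprB [e - c]addrC [x + (_ + e)]addrA -[RHS]addrA [e + q]addrC.
have z2 (x q u : 'cV[C]_d) : x + (q - u) = x - u + q by rewrite [q - _]addrC addrA.
have z3 (c q u e : 'cV[C]_d) : - c + (q + u + e) = u - (c - e) + q.
  by rewrite opprB [RHS]addrC [LHS]addrC -!addrA.
have sel (A : 'I_N -> 'M[C]_d) :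
    blk i *m ((\sum_j (blk j)^t* *m A j *m blk j) *m Y) = A i *m (blk i *m Y).
  rewrite mulmx_suml mulmx_sumr (bigD1 i) //= big1 => [|k ki].
    by rewrite !mulmxA blkK eqxx mul1mx addr0.
  by rewrite !mulmxA blkK eq_sym (negbTE ki) (_ : 0%:R%:M = 0) ?mul0mx // raddf0.
rewrite mulmxDr mulmxBl -scalemxAl mulmxBr -scalemxAr sel /stiffness !mulmxDl !mulmxDr sel.
rewrite mulmx_suml mulmx_sumr.
pose g k := Pmx om (inord k.+1) *m (step k *m Y).
have -> : \sum_(k < N'.+1) blk i *m ((step k)^t* *m Pmx om (inord k.+1) *m step k *m Y) =
    (if i == 0%N :> nat then 0 else g i.-1) - (if i == N'.+1 :> nat then 0 else g i).
  rewrite -sum_step; apply: eq_bigr => k _.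
  by rewrite !mulmxA blk_step !mul_scalar_mx -!scalemxAl -!mulmxA.
have -> : blk i *m (coupling^t* *m x0) =
    (if i == 0%N :> nat then x0 else 0) - (if i == N'.+1 :> nat then C12^t* *m x0 else 0).
  rewrite /coupling trCB mulmxBl mulmxBr !mulmxA trCM mulmxA !blkK -!val_eqE /=.
  by do 2 case: eqP; rewrite ?mul1mx // ?mul_scalar_mx ?scale0r ?mul0mx.
have -> : blk i *m ((blk ord_max)^t* *m C22 *m blk ord_max *m Y) =
    (if i == N'.+1 :> nat then C22 *m (blk ord_max *m Y) else 0).
  rewrite !mulmxA blkK -val_eqE /=.
  by case: eqP; rewrite ?mul1mx -?mulmxA // mul_scalar_mx scale0r.
have -> : flux om x0 Y i = if i == 0%N :> nat then x0 else g i.-1.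
  rewrite /flux; case: eqP => // /eqP i0; rewrite ltn_eqF ?ltn_ord //.
  by rewrite /g prednK // lt0n.
have -> : flux om x0 Y i.+1 =
    if i == N'.+1 :> nat then C12^t* *m x0 - C22 *m (blk ord_max *m Y) else g i.
  by rewrite /flux /= eqSS.
set q := Qmx om i *m _; set w := z *: _.
rewrite addrA; congr (_ - _).
case: (i == 0%N :> nat); case: (i == N'.+1 :> nat); rewrite ?(addr0, add0r, subr0, sub0r, oppr0).
- exact: z1.
- exact: z2.
- exact: z3.
- exact: addrC.
Qed.


Definition phase (om : coefs R d N) (y : seqs R d N) : 'cV[C]_(d + N * d) :=
  col_mx (PDelta om y 0) (stack (fun i => y (inord i.+1))).

Hypothesis hS : S^t* = S.
Hypothesis hnd : nondegeneracy K S.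

Let hC21 : dlsubmx (bc_mx K S) = - C12^t*.
Proof. by have [] := bc_mx_herm hS hnd. Qed.

(** The second condition determines y_(N+1); the first row of the pencil is the
    other half of the boundary condition, where y_0 has been replaced by
    y_1 - P_0^{-1} x_0. *)
Lemma solvesE (om : coefs R d N) (z : C) (y : seqs R d N) : Omega om ->
  solves om (bclass (chart_mx K S)) z y <->
  sl_pencil om z *m phase om y = 0 /\
  PDelta om y N = C12^t* *m PDelta om y 0 - C22 *m y (inord N).
Proof.
move=> hom; have [hP _ _] := hom.
rewrite /solves bclass_cond bc_solved // hC21.
set x0 := PDelta om y 0; set Y := stack (fun i => y (inord i.+1)).
rewrite /sl_pencil /pencil mul_block_col -/x0 -/Y -[0]col_mx0.
have yN : blk ord_max *m Y = y (inord N) by rewrite blk_stack.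
have y1 : blk ord0 *m Y = y (inord 1) by rewrite blk_stack.
have x0E : Pinv om ord0 *m x0 = y (inord 1) - y (inord 0).
  rewrite /x0 /PDelta /Pmx (_ : inord 0 = ord0) ?mulKVmx //; first by have [] := hP ord0.
  by apply: val_inj; rewrite /= inordK.
have row1 : - Tmx K S om *m x0 + coupling *m Y = 0 <->
    - y (inord 0) = - (ulsubmx (bc_mx K S) *m x0 + C12 *m y (inord N)).
  rewrite TmxE // /coupling mulmxBl -mulmxA yN y1 mulNmx mulmxDl x0E.
  set a := _ *m x0; set c := C12 *m _.
  have -> : - (y (inord 1) - y (inord 0) + a) + (y (inord 1) - c) =
      - (a + c) + y (inord 0).
    by rewrite !opprD opprK -!addrA addrCA [- a + _]addrCA addKr addrA addrC.
  split=> [e|/oppr_inj ->]; last exact: addNr.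
  by apply/eqP; rewrite eqr_opp -subr_eq0 addrC e.
have bcN : PDelta om y N = - (- C12^t* *m x0 + C22 *m y (inord N)) <->
    PDelta om y N = C12^t* *m x0 - C22 *m y (inord N).
  by rewrite opprD mulNmx opprK.
have fluxE : PDelta om y N = C12^t* *m x0 - C22 *m y (inord N) ->
    forall j : nat, (j <= N)%N -> flux om x0 Y j = PDelta om y j.
  move=> eN j jN; rewrite /flux; case: eqP => [->//|/eqP j0].
  case: eqP => [->|/eqP jN']; first by rewrite eN yN.
  have [k jk] : exists k, j = k.+1 by exists j.-1; lia.
  have k1 : (k < N'.+1)%N by lia.
  rewrite jk /= /step mulmxBl !blk_stack !inordK //; lia.
split.
- move=> [eqs [bc1 bc2]]; have eN := bcN.1 bc2; split=> //; congr col_mx.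
    exact (proj2 row1 bc1).
  apply: blk_eq0 => i; rewrite sl_row !fluxE // ?ltn_ord //; last exact: ltnW (ltn_ord i).
  by rewrite blk_stack -eqs opprB subrr.
- move=> [/eq_col_mx [e1 e2] eN]; split; last by split; [exact/row1|exact/bcN].
  move=> i; have := sl_row om z x0 Y i; rewrite e2 mulmx0 !fluxE // ?ltn_ord //.
    by rewrite blk_stack opprB => /esym/eqP; rewrite subr_eq0 => /eqP.
  exact: ltnW (ltn_ord i).
Qed.

(** The inverse of [phase] on the sequences that satisfy the boundary condition
    at the right end. *)
Definition unphase (om : coefs R d N) (v : 'cV[C]_(d + N * d)) : seqs R d N :=
  [ffun j : 'I_N.+2 =>
    if j == 0%N :> nat then blk ord0 *m dsubmx v - Pinv om ord0 *m usubmx v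
    else if j == N.+1 :> nat then
      blk ord_max *m dsubmx v + Pinv om ord_max *m
        (C12^t* *m usubmx v - C22 *m (blk ord_max *m dsubmx v))
    else blk (inord j.-1) *m dsubmx v].

Lemma unphaseK om v : Omega om -> phase om (unphase om v) = v.
Proof.
move=> [hP _ _]; rewrite -[RHS]vsubmxK; congr col_mx.
  rewrite /PDelta !ffunE !inordK //= /Pmx.
  rewrite (_ : inord 0 = ord0 :> 'I_N.+1); last by apply: val_inj; rewrite /= inordK.
  rewrite (_ : inord 0 = ord0 :> 'I_N); last by apply: val_inj; rewrite /= inordK.
  by rewrite opprB addrC subrK mulKmx //; have [] := hP ord0.
rewrite -[RHS]stack_blk; congr stack; apply/funext => i.
have hi : (i.+1 < N.+2)%N by rewrite ltnS ltnW // ltnS ltn_ord.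
rewrite ffunE inordK //= eqSS (ltn_eqF (ltn_ord i)).
by congr (blk _ *m _); apply: val_inj; rewrite /= inordK.
Qed.

Lemma unphase_flux om v : Omega om -> let y := unphase om v in
  PDelta om y N = C12^t* *m PDelta om y 0 - C22 *m y (inord N).
Proof.
move=> hom y; have [hP _ _] := hom.
have := unphaseK v hom; rewrite -{2}[v]vsubmxK => /eq_col_mx [-> _].
have yN : y (inord N) = blk ord_max *m dsubmx v.
  rewrite ffunE inordK //= ltn_eqF //.
  by congr (blk _ *m _); apply: val_inj; rewrite /= inordK.
rewrite /PDelta yN ffunE inordK //= eqxx [_ + Pinv _ _ *m _]addrC addrK /Pmx.
rewrite (_ : inord N = ord_max :> 'I_N.+1); last by apply: val_inj; rewrite /= inordK.
by rewrite mulKmx //; have [] := hP ord_max.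
Qed.

Lemma phase_inj om (y : seqs R d N) : Omega om ->
  PDelta om y N = C12^t* *m PDelta om y 0 - C22 *m y (inord N) ->
  phase om y = 0 -> y = 0.
Proof.
move=> [hP _ _] eN; rewrite -[0 in X in X -> _]col_mx0 => /eq_col_mx [x0 Y0].
have yi (i : 'I_N) : y (inord i.+1) = 0.
  by rewrite -(blk_stack (fun i : 'I_N => y (inord i.+1))) Y0 mulmx0.
have inj j (w : 'cV[C]_d) : Pmx om j *m w = 0 -> w = 0.
  move=> e; rewrite -[w](@mulKVmx _ _ _ (Pinv om j)); last by have [] := hP j.
  by rewrite -/(Pmx om j) e mulmx0.
have y1 := yi ord0; have yN := yi ord_max.
move: eN; rewrite x0 mulmx0 yN mulmx0 subrr => /inj; rewrite yN subr0 => yN1.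
move: x0 => /inj; rewrite y1 sub0r => /eqP; rewrite oppr_eq0 => /eqP y0.
apply/ffunP => j; rewrite ffunE.
have [j0|j0] := posnP j.
  by rewrite -y0; congr (y _); apply: val_inj; rewrite /= inordK.
have [jN|jN] := eqVneq (j : nat) N.+1.
  by rewrite -yN1; congr (y _); apply: val_inj; rewrite /= inordK // jN.
have hj : (j.-1 < N)%N.
  have := ltn_ord j; rewrite ltnS leq_eqVlt (negbTE jN) /= ltnS.
  by case: (j : nat) j0.
rewrite -(yi (Ordinal hj)) /= prednK //; congr (y _).
by apply: val_inj; rewrite /= inordK.
Qed.

End Blocks.

(** * Multiplicities and the counting formula *)

Section PencilKernel.
Local Open Scope complex_scope.
Local Open Scope sesquilinear_scope.
Context {R : realType} {d n : nat}.
Local Notation C := (cplx R).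

Lemma herm11_real (A : 'M[C]_1) : A^t* = A -> A 0 0 \is Num.real.
Proof. by move=> hA; apply/CrealP; rewrite -[in RHS]hA [RHS]mxE [in RHS]mxE. Qed.

(** Pairing the equation with the kernel vector gives z w = h with h real and
    w > 0: if the second component vanished, so would the first, as b is onto. *)
Lemma pencil_kernel_real (T : 'M[C]_d) (b : 'M[C]_(d, n)) (b' : 'M[C]_(n, d))
    (M W : 'M[C]_n) (z : C) (v : 'cV[C]_(d + n)) :
  T^t* = T -> M^t* = M ->
  (forall u : 'rV[C]_n, u != 0 -> 0 < (u *m W *m u^t* ) 0 0) ->
  b *m b' = 1%:M -> v != 0 -> pencil T b M W z *m v = 0 -> z \is Num.real.
Proof.
move=> hT hM pW bb'; pose x := usubmx v; pose Y := dsubmx v.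
have -> : v = col_mx x Y by rewrite vsubmxK.
clearbody x Y => v0; rewrite /pencil mul_block_col.
rewrite -[0 in RHS]col_mx0 => /eq_col_mx [e1 e2].
have Y0 : Y != 0.
  apply: contra v0 => /eqP Y0; move: e2; rewrite Y0 mulmx0 addr0 => e2.
  have -> : x = 0; last by rewrite col_mx0.
  by rewrite -[x]mul1mx -trC1 -bb' trCM -mulmxA e2 mulmx0.
have w0 : 0 < (Y^t* *m W *m Y) 0 0.
  have := pW (Y^t* ); rewrite trmxCK; apply.
  by apply: contra Y0 => /eqP e; rewrite -[Y]trmxCK e trC0.
have bY : b *m Y = T *m x by apply/eqP; rewrite -subr_eq0 addrC -mulNmx e1.
have zw : z * (Y^t* *m W *m Y) 0 0 = (x^t* *m T *m x + Y^t* *m M *m Y) 0 0.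
  have -> : x^t* *m T *m x = Y^t* *m (b^t* *m x).
    by rewrite -{1}hT -trCM -bY trCM !mulmxA.
  have e3 : b^t* *m x + M *m Y = z *: (W *m Y).
    apply/eqP; rewrite -subr_eq0 -[_ - _]addrA scalemxAl -mulmxBl.
    by rewrite e2.
  by rewrite -[Y^t* *m M *m Y]mulmxA -mulmxDr e3 -scalemxAr [RHS]mxE mulmxA.
have -> : z = (x^t* *m T *m x + Y^t* *m M *m Y) 0 0 / (Y^t* *m W *m Y) 0 0.
  by rewrite -zw mulfK // gt_eqF.
rewrite rpredM ?rpredV ?(gtr0_real w0) // herm11_real // trCD !trCM !trmxCK hT hM.
by rewrite !mulmxA.
Qed.

End PencilKernel.

Section Spectrum.
Local Open Scope complex_scope.
Local Open Scope sesquilinear_scope.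
Context {R : realType} {d N' : nat}.
Local Notation C := (cplx R).
Local Notation N := N'.+2.
Variables (K : {set 'I_(d + d)}) (S : 'M[C]_(d + d)).
Hypothesis hS : S^t* = S.
Hypothesis hnd : nondegeneracy K S.

Variable om : coefs R d N.
Hypothesis hom : Omega om.

Let bA : bcond R d := bclass (chart_mx K S).
Let T : 'M[C]_d := Tmx K S om.

Lemma invmx_herm n (A : 'M[C]_n) : A^t* = A -> (invmx A)^t* = invmx A.
Proof. by move=> hA; rewrite trmx_inv map_invmx hA. Qed.

Lemma stiffness_herm : (stiffness K S om)^t* = stiffness K S om.
Proof.
have [hP hQ _] := hom; have [_ hC _] := bc_mx_herm hS hnd.
have sum_herm (I : finType) (F : I -> 'M[C]_(N * d)) :
    (forall i, (F i)^t* = F i) -> (\sum_i F i)^t* = \sum_i F i.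
  by move=> hF; rewrite raddf_sum map_mx_sum; apply: eq_bigr => i _; exact: hF.
have congr_herm p (G : 'M[C]_(p, N * d)) A : A^t* = A -> (G^t* *m A *m G)^t* = G^t* *m A *m G.
  by move=> hA; rewrite !trCM trmxCK hA mulmxA.
rewrite /stiffness !trCD !sum_herm ?congr_herm // => i; rewrite congr_herm //.
- by apply: invmx_herm; apply/hermitianP; have [] := hP (inord i.+1).
- exact/hermitianP.
Qed.

Lemma weight_herm : (weight om)^t* = weight om.
Proof.
have [_ _ hW] := hom; rewrite /weight raddf_sum map_mx_sum; apply: eq_bigr => i _.
by have [/hermitianP h _] := hW i; rewrite !trCM trmxCK h mulmxA.
Qed.

Lemma weight_pos (u : 'rV[C]_(N * d)) : u != 0 -> 0 < (u *m weight om *m u^t* ) 0 0.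
Proof.
move=> u0; have [_ _ hW] := hom.
have ge0 i : 0 <= (u *m ((blk i)^t* *m Wmx om i *m blk i) *m u^t* ) 0 0 /\
    (u *m (blk i)^t* != 0 -> 0 < (u *m ((blk i)^t* *m Wmx om i *m blk i) *m u^t* ) 0 0).
  have [_ pW] := hW i.
  have -> : u *m ((blk i)^t* *m Wmx om i *m blk i) *m u^t* =
      ((u *m (blk i)^t* )^t* )^t* *m Wmx om i *m (u *m (blk i)^t* )^t*.
    by rewrite trmxCK trCM trmxCK !mulmxA.
  have [->|ne] := eqVneq (u *m (blk i)^t* ) 0; first by rewrite !trC0 mulmx0 mxE.
  have p : 0 < (((u *m (blk i)^t* )^t* )^t* *m Wmx om i *m (u *m (blk i)^t* )^t* ) 0 0.
    by apply: pW; apply: contra ne => /eqP e; rewrite -[u *m _]trmxCK e trC0.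
  by split=> // ; exact: ltW.
have [i hi] : exists i, u *m (blk i)^t* != 0.
  apply/existsP; apply: contraNT u0; rewrite negb_exists => /forallP h.
  rewrite -[u]mulmx1 -blk_sum mulmx_sumr big1 // => i _.
  by have := h i; rewrite negbK mulmxA => /eqP ->; rewrite mul0mx.
rewrite /weight mulmx_sumr mulmx_suml summxE (bigD1 i) //=.
apply: ltr_wpDr; first by apply: sumr_ge0 => j _; case: (ge0 j).
by case: (ge0 i) => _; apply.
Qed.

Lemma sl_pencil_spectrum : exists s : seq R, [/\ sorted <=%R s,
    (size s + r_zero T)%N = (N * d)%N,
    forall a : R, r_neg (sl_pencil K S om a%:C) =
      (r_pos T + r_zero T + count (fun x => (x < a)%R) s)%N &
    forall a : R, r_pos (sl_pencil K S om a%:C) =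
      (r_neg T + r_zero T + count (fun x => (a < x)%R) s)%N].
Proof.
apply: (pencil_spectrum (b' := (blk ord0)^t* )) => //.
- exact: Tmx_herm.
- exact: stiffness_herm.
- exact: weight_herm.
- exact: weight_pos.
- exact: coupling_onto.
Qed.

Lemma sl_pencil_herm (a : R) : (sl_pencil K S om a%:C)^t* = sl_pencil K S om a%:C.
Proof.
apply: pencil_herm; [exact: Tmx_herm|exact: stiffness_herm|exact: weight_herm].
Qed.

Lemma PDelta_linear (y y' : seqs R d N) a j :
  PDelta om (a *: y + y') j = a *: PDelta om y j + PDelta om y' j.
Proof.
rewrite /PDelta !ffunE opprD addrACA -scalerBr mulmxDr.
by rewrite -scalemxAr.
Qed.

Lemma phase_linear (y y' : seqs R d N) a :
  phase om (a *: y + y') = a *: phase om y + phase om y'.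
Proof.
rewrite /phase PDelta_linear scale_col_mx add_col_mx; congr col_mx.
rewrite /stack scaler_sumr -big_split; apply: eq_bigr => i _ /=.
by rewrite !ffunE mulmxDr -scalemxAr.
Qed.

Lemma phase0 : phase om 0 = 0.
Proof.
by have := phase_linear 0 0 (-1); rewrite scaler0 addr0 scaleN1r addNr.
Qed.

Lemma phase_sum m (k : 'I_m -> C) (ys : 'I_m -> seqs R d N) :
  phase om (\sum_i k i *: ys i) = \sum_i k i *: phase om (ys i).
Proof.
elim: m k ys => [|m IH] k ys; first by rewrite !big_ord0 phase0.
by rewrite !big_ord_recl phase_linear IH.
Qed.

Definition far_end (y : seqs R d N) : Prop :=
  PDelta om y N = (ursubmx (bc_mx K S))^t* *m PDelta om y 0
                  - drsubmx (bc_mx K S) *m y (inord N).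

Lemma far_end_sum m (k : 'I_m -> C) (ys : 'I_m -> seqs R d N) :
  (forall i, far_end (ys i)) -> far_end (\sum_i k i *: ys i).
Proof.
move=> h; elim: m k ys h => [|m IH] k ys h.
  rewrite big_ord0 /far_end.
  have e j : PDelta om 0 j = 0.
    by have := PDelta_linear 0 0 (-1) j; rewrite scaler0 addr0 scaleN1r addNr.
  by rewrite !e ffunE !mulmx0 subrr.
rewrite big_ord_recl /far_end !PDelta_linear (h ord0) (IH _ _ (fun i => h (lift ord0 i))).
by rewrite !ffunE !mulmxDr -!scalemxAr scalerBr opprD addrACA.
Qed.

Lemma eigenfunctionE z y : is_eigenfunction om bA z y <->
  [/\ y != 0, sl_pencil K S om z *m phase om y = 0 & far_end y].
Proof.
split=> [[y0 /(solvesE hS hnd _ _ hom) [e1 e2]]|[y0 e1 e2]]; split=> //.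
by apply/solvesE.
Qed.

(** The dimension of the kernel of the pencil, which acts on columns. *)
Definition eig_dim z := \rank (kermx (sl_pencil K S om z)^T).

(** [phase] is linear and injective on solutions, so it maps a free family of
    eigenfunctions to independent kernel vectors. *)
Lemma eigen_tuple_le z m (ys : m.-tuple (seqs R d N)) :
  free ys -> (forall y, y \in ys -> is_eigenfunction om bA z y) ->
  (m <= eig_dim z)%N.
Proof.
move=> fy ey.
pose A : 'M[C]_(m, d + N * d) := \matrix_(i, j) phase om ys`_i j 0.
have rA (u : 'rV[C]_m) : (u *m A)^T = phase om (\sum_(i < m) u 0 i *: ys`_i).
  rewrite phase_sum; apply/colP => j; rewrite mxE summxE mxE.
  by apply: eq_bigr => i _; rewrite !mxE.
have ysi (i : 'I_m) : is_eigenfunction om bA z ys`_i.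
  by apply: ey; rewrite mem_nth // size_tuple.
have freeA : row_free A.
  rewrite -kermx_eq0; apply/rowV0P => u /sub_kermxP uA0.
  have /phase_inj : phase om (\sum_(i < m) u 0 i *: ys`_i) = 0 by rewrite -rA uA0 trmx0.
  have fe : far_end (\sum_(i < m) u 0 i *: ys`_i).
    by apply: far_end_sum => i; have /eigenfunctionE [] := ysi i.
  have s0 : \sum_(i < m) u 0 i *: ys`_i = 0.
    by apply: (phase_inj hom fe); rewrite -rA uA0 trmx0.
  by move=> _; apply/rowP => i; rewrite mxE; move/freeP: fy => /(_ (fun i => u 0 i) s0 i).
have AK : (A <= kermx (sl_pencil K S om z)^T)%MS.
  apply/sub_kermxP; rewrite -[A]trmxK -trmx_mul -[RHS]trmx0; congr trmx.
  apply/matrixP => i j; rewrite mxE [RHS]mxE.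
  have /eigenfunctionE [_ /colP /(_ i) + _] := ysi j; rewrite !mxE => e0.
  by rewrite -[RHS]e0; apply: eq_bigr => k _; rewrite !mxE.
by rewrite /eig_dim -(eqP freeA); exact: mxrankS.
Qed.

Lemma eigen_tuple_exists z : exists ys : (eig_dim z).-tuple (seqs R d N),
  free ys /\ (forall y, y \in ys -> is_eigenfunction om bA z y).
Proof.
pose A := row_base (kermx (sl_pencil K S om z)^T).
pose y (i : 'I_(eig_dim z)) := unphase K S om (row i A)^T.
have fA : row_free A := row_base_free _.
have phy i : phase om (y i) = (row i A)^T by exact: unphaseK.
have ker i : sl_pencil K S om z *m (row i A)^T = 0.
  apply: trmx_inj; rewrite trmx_mul trmxK trmx0; apply/sub_kermxP.
  by rewrite (submx_trans (row_sub _ _)) // eq_row_base.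
exists [tuple y i | i < eig_dim z].
have nthy (i : 'I_(eig_dim z)) : [tuple y i | i < eig_dim z]`_i = y i.
  by rewrite -tnth_nth tnth_mktuple.
have fr : free [tuple y i | i < eig_dim z].
  apply/freeP => k s0 i.
  have : phase om (\sum_(i < eig_dim z) k i *: y i) = 0.
    by rewrite -[RHS]phase0; congr phase; rewrite -[RHS]s0; apply: eq_bigr => j _; rewrite nthy.
  rewrite phase_sum => e.
  have /(row_free_inj fA) /rowP /(_ i) : (\row_j k j) *m A = 0 *m A.
    rewrite mul0mx; apply: trmx_inj; rewrite trmx0 -[RHS]e; apply/colP => j.
    by rewrite mxE summxE mxE; apply: eq_bigr => l _; rewrite phy !mxE.
  by rewrite !mxE.
split=> // w wy; apply/eigenfunctionE.
have w0 : w != 0 := free_not0 fr wy.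
case/mapP: wy w0 => i _ -> w0; split=> //; first by rewrite phy ker.
exact: unphase_flux.
Qed.

Lemma multiplicityE z : multiplicity om bA z = eig_dim z.
Proof.
apply/eqP; rewrite eqn_leq; apply/andP; split.
  by apply/bigmax_leqP => m /asboolP [ys [fy ey]]; exact: eigen_tuple_le fy ey.
have [ys [fy ey]] := eigen_tuple_exists z.
have hd : (eig_dim z < (\dim {: seqs R d N}).+1)%N.
  by rewrite ltnS -[X in (X <= _)%N](size_tuple ys) -(eqP fy) dimvS // subvf.
rewrite /multiplicity (bigop.bigmax_sup (Ordinal hd)) //.
by apply/asboolP; exists ys.
Qed.

Lemma eigenvalueE z : is_eigenvalue om bA z <-> (0 < eig_dim z)%N.
Proof.
split=> [[y]|].
  move=> /eigenfunctionE [y0 e f]; rewrite /eig_dim lt0n mxrank_eq0; apply/rowV0Pn.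
  exists (phase om y)^T; first by apply/sub_kermxP; rewrite -trmx_mul e trmx0.
  rewrite trmx_eq0; apply: contra y0 => /eqP p0.
  by rewrite (phase_inj hom f p0).
have [ys [fy ey]] := eigen_tuple_exists z => h.
by exists ys`_0; apply: ey; rewrite mem_nth // size_tuple.
Qed.

Lemma eigenvalue_real z : (0 < eig_dim z)%N -> z \is Num.real.
Proof.
rewrite /eig_dim lt0n mxrank_eq0 => /rowV0Pn [v /sub_kermxP vk v0].
apply: (@pencil_kernel_real _ _ _ T (coupling K S) ((blk ord0)^t* )
  (stiffness K S om) (weight om) z v^T).
- exact: Tmx_herm.
- exact: stiffness_herm.
- exact: weight_pos.
- exact: coupling_onto.
- by rewrite trmx_eq0.
- by rewrite -/(sl_pencil K S om z) -[sl_pencil _ _ _ _]trmxK -trmx_mul vk trmx0.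
Qed.

Lemma is_spectrum_unique s s' :
  is_spectrum om bA s -> is_spectrum om bA s' -> s = s'.
Proof.
move=> [h1 h2 h3] [h1' h2' h3']; apply: (sorted_eq le_trans le_anti) => //.
apply/allP => x _ /=; apply/eqP.
have cm l : count_mem (x%:C : C) [seq y%:C | y <- l] = count_mem x l.
  by rewrite count_map; apply: eq_count => y /=; apply/eqP/eqP => [[]|->].
rewrite -!cm; have [e|ne] := pselect (is_eigenvalue om bA x%:C).
  by rewrite h3 // h3'.
rewrite !(count_memPn _) //; apply/negP.
  by move/h2'.
by move/h2.
Qed.

(** The multiplicity of a real [a] is the nullity of the pencil, which the sum
    of the two counts of [pencil_spectrum] determines; a non-real number is
    not an eigenvalue by [pencil_kernel_real]. *)
Theorem spectrum_count :
  [/\ sorted <=%R (spectrum om bA),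
      (nb_eigenvalues om bA + r_zero T)%N = (N * d)%N &
      forall a : R,
        [/\ r_neg (sl_pencil K S om a%:C) =
              (r_pos T + r_zero T + count (fun x => (x < a)%R) (spectrum om bA))%N &
            r_zero (sl_pencil K S om a%:C) = count_mem a (spectrum om bA)]].
Proof.
have [s [s1 s2 s3 s4]] := sl_pencil_spectrum.
have hT : T^t* = T by exact: Tmx_herm.
have z0 (a : R) : r_zero (sl_pencil K S om a%:C) = count_mem a s.
  have := inertia_sum (sl_pencil_herm a); have := inertia_sum hT; rewrite s3 s4.
  have : (count (fun x => (x < a)%R) s + count_mem a s + count (fun x => (a < x)%R) s)%N = size s.
    by elim: (s) => //= x l <-; case: (ltgtP x a) => /= _; lia.
  move: s2; lia.
have ed (a : R) : eig_dim a%:C = count_mem a s.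
  rewrite -z0 /eig_dim mxrank_ker mxrank_tr -{1}(rank_r_zero (sl_pencil_herm a)).
  by rewrite addKn.
have cm (x : R) l : count_mem (x%:C : C) [seq y%:C | y <- l] = count_mem x l.
  by rewrite count_map; apply: eq_count => y /=; apply/eqP/eqP => [[]|->].
have sp : is_spectrum om bA s.
  split=> // z.
    rewrite eigenvalueE -has_pred1 has_count; split=> h.
      by have /RRe_real zr := eigenvalue_real h; rewrite -zr cm -ed zr.
    have : has (pred1 z) [seq y%:C | y <- s] by rewrite has_count.
    rewrite has_pred1 => /mapP [x _ zx]; move: h; rewrite zx cm.
    by rewrite ed.
  rewrite eigenvalueE multiplicityE => /eigenvalue_real /RRe_real zr.
  by rewrite -zr cm ed.
have spE : spectrum om bA = s.
  apply: (is_spectrum_unique _ sp).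
  exact: (@xgetPex _ [::] [set l | is_spectrum om bA l] (ex_intro _ s sp)).
by rewrite /nb_eigenvalues spE; split=> // a; split.
Qed.

End Spectrum.

(** * Limits of eigenvalues *)

Section OrderedCounting.
Local Open Scope complex_scope.
Local Open Scope sesquilinear_scope.
Context {R : realType}.

Lemma avoid_seq (s : seq R) (x y : R) : x < y -> exists2 z, x < z < y & z \notin s.
Proof.
elim: s x y => [|a s IH] x y xy.
  by exists ((x + y) / 2) => //; rewrite !(midf_lt xy).
have [z /andP[xz zy] zs] := IH _ _ xy.
have [za|za] := eqVneq z a; last by exists z; rewrite ?xz // inE negb_or za.
have [t /andP[xt tz] ts] := IH _ _ xz.
by exists t; rewrite ?xt ?(lt_trans tz) // inE negb_or ts -za lt_eqF.
Qed.

Lemma nth_lt_count (s : seq R) n a : sorted <=%R s -> (0 < n <= size s)%N ->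
  (nth 0 s n.-1 < a) = (n <= count (fun x => (x < a)%R) s)%N.
Proof.
move=> ss /andP[n0 ns]; apply/idP/idP => [|h].
  apply: contraLR; rewrite -ltnNge -leNgt => h.
  apply: (nth_count_ge (x := a)) => //.
  by rewrite prednK // ns andbT -ltnS prednK.
by apply: nth_count_lt => //; rewrite prednK.
Qed.

End OrderedCounting.

Section Limits.
Local Open Scope complex_scope.
Local Open Scope sesquilinear_scope.
Context {R : realType} {d N' : nat}.
Local Notation C := (cplx R).
Local Notation N := N'.+2.
Variables (K : {set 'I_(d + d)}) (S : 'M[C]_(d + d)).
Hypothesis hS : S^t* = S.
Hypothesis hnd : nondegeneracy K S.
Let bA : bcond R d := bclass (chart_mx K S).

Lemma Pinv_cvg (om : coefs R d N) j : mxcvg (nbhs om) (fun s => Pinv s j) (Pinv om j).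
Proof.
move=> i k; apply: (@cvg_comp _ _ _ (fun s : coefs R d N => Pinv s j) (fun M => M i k) _ (nbhs (Pinv om j))).
  rewrite /Pinv.
  apply: (@cvg_comp _ _ _ (fun s : coefs R d N => s.1.1) (fun f => f j) _ (nbhs om.1.1)).
    apply: (@cvg_comp _ _ _ (fun s : coefs R d N => s.1) fst _ (nbhs om.1)).
      exact: cvg_fst.
    exact: cvg_fst.
  exact: (@proj_continuous _ (fun=> 'M[C]_d) j om.1.1).
exact: coord_continuous.
Qed.

Lemma Qmx_cvg (om : coefs R d N) j : mxcvg (nbhs om) (fun s => Qmx s j) (Qmx om j).
Proof.
move=> i k; apply: (@cvg_comp _ _ _ (fun s : coefs R d N => Qmx s j) (fun M => M i k) _ (nbhs (Qmx om j))).
  rewrite /Qmx.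
  apply: (@cvg_comp _ _ _ (fun s : coefs R d N => s.1.2) (fun f => f j) _ (nbhs om.1.2)).
    apply: (@cvg_comp _ _ _ (fun s : coefs R d N => s.1) snd _ (nbhs om.1)).
      exact: cvg_fst.
    exact: cvg_snd.
  exact: (@proj_continuous _ (fun=> 'M[C]_d) j om.1.2).
exact: coord_continuous.
Qed.

Lemma Wmx_cvg (om : coefs R d N) j : mxcvg (nbhs om) (fun s => Wmx s j) (Wmx om j).
Proof.
move=> i k; apply: (@cvg_comp _ _ _ (fun s : coefs R d N => Wmx s j) (fun M => M i k) _ (nbhs (Wmx om j))).
  rewrite /Wmx.
  apply: (@cvg_comp _ _ _ (fun s : coefs R d N => s.2) (fun f => f j) _ (nbhs om.2)).
    exact: cvg_snd.
  exact: (@proj_continuous _ (fun=> 'M[C]_d) j om.2).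
exact: coord_continuous.
Qed.

Section At.
Variables (A : set (coefs R d N)) (om : coefs R d N).
Hypotheses (AO : A `<=` Omega) (hom : Omega om).
Local Notation F := (within A (nbhs om)).

Lemma mxcvg_within m n (f : coefs R d N -> 'M[C]_(m, n)) L :
  mxcvg (nbhs om) f L -> mxcvg F f L.
Proof. by move=> h i j; apply: cvg_trans (h i j); apply/cvg_app/cvg_within. Qed.

Lemma near_Omega : \forall s \near F, Omega s.
Proof. by apply: filterS (withinT _ _); exact: AO. Qed.

Lemma Tmx_cvg : mxcvg F (Tmx K S) (Tmx K S om).
Proof.
rewrite (_ : Tmx K S = fun s : coefs R d N => Pinv s ord0 + ulsubmx (bc_mx K S)).
  by apply: mxcvgD; [exact/mxcvg_within/Pinv_cvg|exact: mxcvg_cst].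
by apply/funext => s; rewrite TmxE.
Qed.

Lemma Pmx_cvg j : mxcvg F (fun s => Pmx s j) (Pmx om j).
Proof.
have [hP _ _] := hom; apply: mxcvg_invmx; first exact/mxcvg_within/Pinv_cvg.
  by have [] := hP j.
by apply: filterS near_Omega => s [hs _ _]; have [] := hs j.
Qed.

Lemma sl_pencil_cvg z : mxcvg F (fun s => sl_pencil K S s z) (sl_pencil K S om z).
Proof.
apply: mxcvg_block; [by apply: mxcvgN; exact: Tmx_cvg|exact: mxcvg_cst|exact: mxcvg_cst|].
apply: mxcvgD.
  apply: mxcvgD; last exact: mxcvg_cst.
  apply: mxcvgD; apply: mxcvg_sum => i _; apply: mxcvg_sandwich.
    exact/mxcvg_within/Qmx_cvg.
  exact: Pmx_cvg.
rewrite (_ : (fun x => - (z *: weight x)) = fun x => - (z%:M *m weight x)); last first.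
  by apply/funext => x; rewrite mul_scalar_mx.
rewrite -mul_scalar_mx; apply: mxcvgN; apply: mxcvgM; first exact: mxcvg_cst.
by apply: mxcvg_sum => i _; apply: mxcvg_sandwich; exact/mxcvg_within/Wmx_cvg.
Qed.

Lemma near_r_neg_T : (\forall s \near F, (r_zero (Tmx K S om) <= r_zero (Tmx K S s))%N) ->
  \forall s \near F, r_neg (Tmx K S s) = r_neg (Tmx K S om).
Proof.
apply: r_neg_locally_constant; [exact: Tmx_herm|exact: Tmx_cvg|].
by apply: filterS near_Omega => s; exact: Tmx_herm.
Qed.

(** [a] not being an eigenvalue, the pencil at [a] is
    invertible, so its inertia is locally constant and [spectrum_count] relates
    the two counts. *)
Lemma near_count (a : R) : a \notin spectrum om bA -> \forall s \near F,
  (count (fun x => (x < a)%R) (spectrum s bA) + r_neg (Tmx K S om) =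
   count (fun x => (x < a)%R) (spectrum om bA) + r_neg (Tmx K S s))%N.
Proof.
move=> ha; have [_ _ /(_ a) [e0 z0]] := spectrum_count hS hnd hom.
have L0 : r_zero (sl_pencil K S om a%:C) = 0%N by rewrite z0; apply/count_memPn.
have hL := sl_pencil_herm hS hnd hom a.
have hLs : \forall s \near F, (sl_pencil K S s a%:C)^t* = sl_pencil K S s a%:C.
  by apply: filterS near_Omega => s hs; exact: sl_pencil_herm.
have hz : \forall s \near F,
    (r_zero (sl_pencil K S om a%:C) <= r_zero (sl_pencil K S s a%:C))%N.
  have L0le m : (r_zero (sl_pencil K S om a%:C) <= m)%N by rewrite L0.
  by apply: nearW => s; exact: L0le.
have arith p z c r p' z' c' r' : (p + z + c = p' + z' + c')%N -> (z + p + r = d)%N ->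
    (z' + p' + r' = d)%N -> (c + r' = c' + r)%N by lia.
have near_eq : \forall s \near F,
    r_neg (sl_pencil K S s a%:C) = r_neg (sl_pencil K S om a%:C).
  by apply: (r_neg_locally_constant hL _ hLs hz); exact: sl_pencil_cvg.
apply: filterS2 near_Omega near_eq => s hs es.
have [_ _ /(_ a) [e1 _]] := spectrum_count hS hnd hs.
exact: arith (etrans (esym e1) (etrans es e0)) (inertia_sum (Tmx_herm hS hnd hs))
  (inertia_sum (Tmx_herm hS hnd hom)).
Qed.

Variable (e n : nat).
Hypothesis n0 : (0 < n)%N.
Hypothesis near_shift : \forall s \near F,
  r_neg (Tmx K S s) = (r_neg (Tmx K S om) + e)%N.
Hypothesis near_dom : \forall s \near F, (n <= nb_eigenvalues s bA)%N.

(** With [e] the number of negative eigenvalues that [Tmx] gains near [om]: all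
    the levels [a] outside a finite set are compared with the n-th eigenvalue
    by a condition on the spectrum at [om] alone. *)
Lemma near_lambda_lt (a : R) : a \notin spectrum om bA -> \forall s \near F,
  (lambda N bA n s < a) =
  (n <= count (fun x => (x < a)%R) (spectrum om bA) + e)%N.
Proof.
move=> ha; have nc := near_count ha; near=> s.
have hs : Omega s by near: s; exact: near_Omega.
have [ss _ _] := spectrum_count hS hnd hs.
have dom : (n <= nb_eigenvalues s bA)%N by near: s; exact: near_dom.
have arith (x y t : nat) : (x + t = y + (t + e))%N -> (n <= x)%N = (n <= y + e)%N.
  by move=> h; congr (_ <= _)%N; lia.
rewrite /lambda nth_lt_count ?n0 //; apply: (arith _ _ (r_neg (Tmx K S om))).
have <- : r_neg (Tmx K S s) = (r_neg (Tmx K S om) + e)%N by near: s.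
by near: s.
Unshelve. all: by end_near. Qed.

Lemma lambda_cvg : (e < n <= e + nb_eigenvalues om bA)%N ->
  lambda N bA n s @[s --> F] --> lambda N bA (n - e) om.
Proof.
move=> /andP[en ne]; set l := lambda _ _ _ om.
have [so _ _] := spectrum_count hS hnd hom.
have nth_om a : (l < a) = (n - e <= count (fun x => (x < a)%R) (spectrum om bA))%N.
  by rewrite /l /lambda nth_lt_count // subn_gt0 en leq_subLR.
apply/cvgrPdist_lt => eps eps0.
(* levels on both sides of the limit that are not eigenvalues *)
have l1 : l < l + eps by rewrite ltrDl.
have l2 : l - eps < l by rewrite ltrBlDr ltrDl.
have [a /andP[la ae] ha] := avoid_seq (spectrum om bA) l1.
have [b /andP[eb bl] hb] := avoid_seq (spectrum om bA) l2.
near=> s.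
have h1 : lambda N bA n s < a.
  have -> : (lambda N bA n s < a) = (n <= count (fun x => (x < a)%R) (spectrum om bA) + e)%N.
    by near: s; exact: near_lambda_lt.
  by have := la; rewrite nth_om leq_subLR addnC.
have h2 : b <= lambda N bA n s.
  have -> : (b <= lambda N bA n s) = ~~ (n <= count (fun x => (x < b)%R) (spectrum om bA) + e)%N.
    by rewrite leNgt; congr (~~ _); near: s; exact: near_lambda_lt.
  by rewrite addnC -leq_subLR -nth_om -leNgt ltW.
rewrite ltr_norml; apply/andP; split; lra.
Unshelve. all: by end_near. Qed.

(** Near [om] at least [e] eigenvalues lie below any given level. *)
Lemma lambda_cvgNy : (n <= e)%N -> lambda N bA n s @[s --> F] --> -oo.
Proof.
move=> ne; apply/cvgrNyPler => a _.
have a1 : a - 1 < a by rewrite ltrBlDr ltrDl.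
have [b /andP[_ ba] hb] := avoid_seq (spectrum om bA) a1.
near=> s; apply/ltW/(lt_trans _ ba).
have -> : (lambda N bA n s < b) = (n <= count (fun x => (x < b)%R) (spectrum om bA) + e)%N.
  by near: s; exact: near_lambda_lt.
by rewrite (leq_trans ne) // leq_addl.
Unshelve. all: by end_near. Qed.

(** Beyond the [e] new ones, only as many eigenvalues as there are at [om] can
    stay below a fixed level. *)
Lemma lambda_cvgy : (e + nb_eigenvalues om bA < n)%N ->
  lambda N bA n s @[s --> F] --> +oo.
Proof.
move=> ne; apply/cvgryPger => a _.
have a1 : a < a + 1 by rewrite ltrDl.
have [b /andP[ab _] hb] := avoid_seq (spectrum om bA) a1.
near=> s; apply/(le_trans (ltW ab)).
have -> : (b <= lambda N bA n s) = ~~ (n <= count (fun x => (x < b)%R) (spectrum om bA) + e)%N.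
  by rewrite leNgt; congr (~~ _); near: s; exact: near_lambda_lt.
rewrite -ltnNge (leq_ltn_trans _ ne) // addnC leq_add2l; exact: count_size.
Unshelve. all: by end_near. Qed.

End At.

Lemma unitmx_shift n (A : 'M[C]_n) (a : R) : A^t* = A ->
  a \notin [seq complex.Re x | x <- eigenvalues A] -> A - (a%:C)%:M \in unitmx.
Proof.
move=> hA ha.
have hB : (A - (a%:C)%:M)^t* = A - (a%:C)%:M.
  rewrite trCB hA tr_scalar_mx map_scalar_mx /=; congr (_ - _%:M).
  by apply/CrealP; rewrite complex_real.
rewrite -row_free_unit /row_free; apply/eqP; have := rank_r_zero hB.
suff -> : r_zero (A - (a%:C)%:M) = 0%N by rewrite addn0.
apply/eqP; rewrite /r_zero (permP (perm_eigenvalues_shift _ hA)) count_map -leqn0 leqNgt -has_count.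
apply: contra ha => /hasP [x xA /=]; rewrite subr_eq0 => /eqP xa.
by apply/mapP; exists x => //; rewrite xa.
Qed.

(** Subtracting a scalar matrix [a] from P_0^{-1} subtracts the same matrix from
    [Tmx]; both remain invertible for all [a] outside a finite set. *)
Lemma nullity0_dense (om : coefs R d N) : Omega om ->
  closure [set s : coefs R d N | Omega s /\ nullity K S s = 0%N] om.
Proof.
move=> hom B hB; have [hP hQ hW] := hom; have [hP0 uP0] := hP ord0.
pose g (X : 'M[C]_d) : {ptws 'I_N.+1 -> 'M[C]_d} := dfwith om.1.1 ord0 X.
pose f (X : 'M[C]_d) : coefs R d N := (g X, om.1.2, om.2).
have f0 : f (Pinv om ord0) = om.
  rewrite /f /g; case: om {hB hP hQ hW hom hP0 uP0 f g} => [[P Q] W] /=; congr (_, _, _).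
  apply/funext => j; have [->|j0] := eqVneq j ord0; first by rewrite dfwithin.
  by rewrite dfwithout // eq_sym.
have cf : f X @[X --> nbhs (Pinv om ord0)] --> f (Pinv om ord0).
  have c1 := @dfwith_continuous _ (fun=> 'M[C]_d) om.1.1 ord0 (Pinv om ord0).
  have c2 := @cvg_pair _ _ _ (nbhs (Pinv om ord0)) (nbhs (g (Pinv om ord0))) (nbhs om.1.2)
    (nbhs_filter _) (nbhs_filter _) (nbhs_filter _) g (fun=> om.1.2) c1
    (@cvg_cst _ om.1.2 _ _ (nbhs_filter _)).
  have c3 := @cvg_pair _ _ _ (nbhs (Pinv om ord0)) (nbhs (g (Pinv om ord0), om.1.2))
    (nbhs om.2) (nbhs_filter _) (nbhs_filter _) (nbhs_filter _)
    (fun X => (g X, om.1.2)) (fun=> om.2) c2 (@cvg_cst _ om.2 _ _ (nbhs_filter _)).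
  exact: c3.
have /nbhs_ballP [e /= e0 he] : nbhs (Pinv om ord0) (f @^-1` B).
  by apply: cf; rewrite f0.
have [re [r0 eE]] : exists r : R, 0 < r /\ e = r%:C.
  exists (complex.Re e); rewrite RRe_real ?gtr0_real //; split=> //.
  by rewrite -(@ltcR R) RRe_real ?gtr0_real.
have hPC : (Pinv om ord0)^t* = Pinv om ord0 by exact/hermitianP.
have hTC := Tmx_herm hS hnd hom.
have [a /andP[a0 ae] ha] := avoid_seq
  ([seq complex.Re x | x <- eigenvalues (Pinv om ord0)] ++
   [seq complex.Re x | x <- eigenvalues (Tmx K S om)]) r0.
move: ha; rewrite mem_cat negb_or => /andP[ha1 ha2].
pose X := Pinv om ord0 - (a%:C)%:M.
have PX j : Pinv (f X) j = if j == ord0 then X else Pinv om j.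
  rewrite /Pinv /f /g /=; have [->|j0] := eqVneq j ord0; first by rewrite dfwithin.
  by rewrite dfwithout // eq_sym.
have XC : X^t* = X.
  rewrite /X trCB hPC tr_scalar_mx map_scalar_mx /=; congr (_ - _%:M).
  by apply/CrealP; rewrite complex_real.
have uX : X \in unitmx := unitmx_shift hPC ha1.
have uT : Tmx K S om - (a%:C)%:M \in unitmx := unitmx_shift hTC ha2.
have hf : Omega (f X).
  split=> // j; rewrite PX; case: eqP => [_|_]; last exact: hP.
  by split; [exact/hermitianP|exact: uX].
exists (f X); split; last first.
  apply: he; split=> // i k; rewrite /ball /= /X !mxE opprB addrC subrK.
  case: (i == k); last by rewrite mulr0n normr0.
  by rewrite mulr1n eE gtr0_norm ?ltcR.
split=> //; rewrite nullity_r_zero //.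
have hTX : Tmx K S (f X) = Tmx K S om - (a%:C)%:M.
  by rewrite !TmxE // PX eqxx /X addrAC.
have rT : \rank (Tmx K S (f X)) = d by rewrite hTX mxrank_unit.
have arith (x y : nat) : x = d -> (x + y)%N = d -> y = 0%N.
  by move=> ->; rewrite -{2}[d]addn0 => /addnI.
exact: arith rT (rank_r_zero (Tmx_herm hS hnd hf)).
Qed.

End Limits.

(** * Continuity, jumps and the singular set *)

Theorem theorem4p9 (R : realType) (d N : nat) (hd : (1 <= d)%N) (hN : (2 <= N)%N)
  (K : {set 'I_(d + d)}) (bA : bcond R d) (hbA : calO K bA)
  (S : 'M[cplx R]_(d + d)) (hS : S \is hermsymmx)
  (hAS : bA = bclass (chart_mx K S)) (hnd : nondegeneracy K S) :
  [/\ forall k : nat, (k <= l_1 N K S)%N ->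
        forall n : nat, (1 <= n <= N * d - k)%N ->
          calE N K S k `<=` lambda_dom N bA n /\
          {within calE N K S k, continuous (lambda N bA n)},
      forall r0 rp rm s0 sp sm : nat,
        (r0 + rp + rm = d)%N -> (s0 + sp + sm = d)%N ->
        calE_sign N K S r0 rp rm !=set0 ->
        calE_sign N K S s0 sp sm !=set0 ->
        (r0 < s0 <= l_1 N K S)%N -> (sp <= rp)%N -> (sm <= rm)%N ->
        forall om : coefs R d N, calE_sign N K S s0 sp sm om ->
        [/\ forall n : nat, (1 <= n <= N * d - r0)%N ->
              calE_sign N K S r0 rp rm `<=` lambda_dom N bA n,
            forall n : nat, (1 <= n <= rm - sm)%N ->
              lambda N bA n s @[s --> within (calE_sign N K S r0 rp rm) (nbhs om)]
                --> -oo,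
            forall n : nat, (rm - sm < n <= N * d - r0 - (rp - sp))%N ->
              lambda_dom N bA (n - (rm - sm)) om /\
              lambda N bA n s @[s --> within (calE_sign N K S r0 rp rm) (nbhs om)]
                --> lambda N bA (n - (rm - sm)) om &
            forall n : nat,
              (N * d - r0 - (rp - sp) < n <= N * d - r0)%N ->
              lambda N bA n s @[s --> within (calE_sign N K S r0 rp rm) (nbhs om)]
                --> +oo] &
      singular_set N bA =
        \bigcup_(k in [set k : nat | (1 <= k <= l_1 N K S)%N])
          calE N K S k].
Proof.
case: N hN => [|[|N']] // _; set N := N'.+2.
have hSC : S^t*%sesqui = S by exact/hermitianP.
pose bA' := bclass (chart_mx K S); rewrite hAS -/bA'.
have rz (om : coefs R d N) : Omega om -> nullity K S om = r_zero (Tmx K S om).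
  by move=> hom; exact: nullity_r_zero.
have nb (om : coefs R d N) : Omega om ->
    (nb_eigenvalues om bA' + r_zero (Tmx K S om) = N * d)%N.
  by move=> hom; have [] := spectrum_count hSC hnd hom.
split.
- move=> k kl n /andP[n1 nk].
  have dom (s : coefs R d N) : calE N K S k s -> (n <= nb_eigenvalues s bA')%N.
    move=> [hs nul]; have := nb s hs; rewrite -rz // nul => h.
    by rewrite (leq_trans nk) // -h addnK.
  split=> [s hs|]; first by split; [case: hs|exact: dom].
  apply/subspace_continuousP => om hom; have [hom1 nul] := hom.
  have AO : calE N K S k `<=` Omega by move=> s [].
  have := @lambda_cvg R d N' K S hSC hnd (calE N K S k) om AO hom1 0 n n1.
  rewrite subn0 add0n; apply; last by rewrite n1 dom.
    have hz : \forall s \near within (calE N K S k) (nbhs om),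
        (r_zero (Tmx K S om) <= r_zero (Tmx K S s))%N.
      by apply: filterS (withinT _ _) => s [hs nuls]; rewrite -!rz // nul nuls.
    by apply: filterS (near_r_neg_T hSC hnd AO hom1 hz) => s ->; rewrite addn0.
  by apply: filterS (withinT _ _); exact: dom.
- move=> r0 rp rm s0 sp sm hr hs _ _ /andP[rs sl] pp mm om [hom [z0 p0 m0]].
  set A := calE_sign N K S r0 rp rm.
  have AO : A `<=` Omega by move=> s [].
  have dom (s : coefs R d N) n : A s -> (n <= N * d - r0)%N -> (n <= nb_eigenvalues s bA')%N.
    move=> [hs1 [zs _ _]] h; have := nb s hs1; rewrite zs => e.
    by rewrite (leq_trans h) // -e addnK.
  have shift : \forall s \near within A (nbhs om),
      r_neg (Tmx K S s) = (r_neg (Tmx K S om) + (rm - sm))%N.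
    by apply: filterS (withinT _ _) => s [_ [_ _ ->]]; rewrite m0 subnKC.
  have ndom n : (n <= N * d - r0)%N ->
      \forall s \near within A (nbhs om), (n <= nb_eigenvalues s bA')%N.
    by move=> h; apply: filterS (withinT _ _) => s hs1; exact: dom.
  have nbo := nb om hom; rewrite z0 in nbo.
  split.
  + by move=> n /andP[_ h] s hs1; split; [exact: AO|exact: dom].
  + move=> n /andP[n1 h]; apply: (lambda_cvgNy hSC hnd AO hom n1 shift) => //.
    by apply: ndom; lia.
  + move=> n /andP[n1 h]; split; first by split=> //; lia.
    have c : (rm - sm < n <= rm - sm + nb_eigenvalues om bA')%N by lia.
    by apply: (lambda_cvg hSC hnd AO hom _ shift _ c); [lia|apply: ndom; lia].
  + move=> n /andP[n1 h].
    have c : (rm - sm + nb_eigenvalues om bA' < n)%N by lia.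
    by apply: (lambda_cvgy hSC hnd AO hom _ shift _ c); [lia|apply: ndom; lia].
- apply/seteqP; split=> om.
  + move=> [hom [n [/andP[n1 nN] sing]]].
    have [n0|n0] := posnP (nullity K S om); last first.
      exists (nullity K S om) => //=; rewrite n0 /=.
      have h : (nullity K S om < (d + d).+1)%N by rewrite ltnS leq_subr.
      rewrite /l_1 (bigop.bigmax_sup (Ordinal h)) //.
      by apply/asboolP; exists om.
    exfalso; have nbo := nb om hom; rewrite -rz // n0 addn0 in nbo.
    have dom : lambda_dom N bA' n om by split=> //; rewrite nbo.
    case: sing => [[_]|[]] //; apply.
    have AO : lambda_dom N bA' n `<=` Omega by move=> s [].
    have := @lambda_cvg R d N' K S hSC hnd (lambda_dom N bA' n) om AO hom 0 n n1.
    rewrite subn0 add0n; apply; last by rewrite n1 nbo.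
      have T0 m : (r_zero (Tmx K S om) <= m)%N by rewrite -rz // n0.
      have hz : \forall s \near within (lambda_dom N bA' n) (nbhs om),
        (r_zero (Tmx K S om) <= r_zero (Tmx K S s))%N by apply: nearW => s; exact: T0.
      by apply: filterS (near_r_neg_T hSC hnd AO hom hz) => s ->; rewrite addn0.
    by apply: filterS (withinT _ _) => s [].
  + move=> [k /= /andP[k1 kl] [hom nul]]; split=> //.
    exists (N * d)%N; split; first by rewrite muln_gt0 hd leqnn.
    right; split.
      move=> [_]; have := nb om hom; rewrite -rz // nul; lia.
    apply: closureS (nullity0_dense hSC hnd hom) => s [hs n0]; split=> //.
    by have := nb s hs; rewrite -rz // n0 addn0 => ->.
Qed.
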